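(* Let $A$ be a Noetherian UFD, let $M$ be a componentwise free $A[\mathbf x]$-module with $\operatorname{rdim}_A(M)=r$, and let $\underline f=(f_0,\dots,f_r)$ be a sequence of elements of $A[\mathbf x]$ that is a filter-regular sequence for $M$. Let $\mathfrak p$ be a prime ideal of $A$, $\kappa=A_{\mathfrak p}/\mathfrak pA_{\mathfrak p}$ its residue field, $\overline M=M\otimes_A\kappa$, $\pi:A[\mathbf x]\to\kappa[\mathbf x]$ the natural map, $(\pi(\underline f))$ the ideal of $\kappa[\mathbf x]$ generated by $\pi(f_0),\dots,\pi(f_r)$, and $N:=\overline M/(\pi(\underline f))\overline M$. Suppose that $\operatorname{fgr}\big((\pi(\underline f)),\overline M\big)=r$. Then $$\operatorname{ord}_{\mathfrak p}\big(\operatorname{Res}_A(\underline f,M)\big)\ \ge\ \operatorname{rdeg}_\kappa(N),$$ where $\operatorname{Res}_A(\underline f,M)\in A/A^\times$ is the $M$-resultant of $\underline f$.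
   Context: Rings are commutative with $1$. Fix an integer $q\ge1$. $\mathbb N^q$ is ordered componentwise; a property holds ''for $\nu\in\mathbb N^q$ large enough'' if there is $\nu_0$ such that it holds for all $\nu\ge\nu_0$. Multigraded rings and modules are graded by $\mathbb N^q$ ($R=\bigoplus_{d}R_d$, $R_aR_b\subseteq R_{a+b}$, $M=\bigoplus_{d\in\mathbb N^q} M_d$, $R_aM_b\subseteq M_{a+b}$). A multigraded module $M$ is eventually zero if $M_d=0$ for $d$ large enough. Fix $n_1,\dots,n_q\ge1$ and variables $\mathbf x=(x_{p,i})_{1\le p\le q,\,0\le i\le n_p}$. For a ring $A$, $A[\mathbf x]$ is multigraded with elements of $A$ in multidegree $0$ and $x_{p,i}$ of multidegree $\mathbf e_p$ (the $p$-th canonical basis vector of $\mathbb N^q$). A componentwise free $A[\mathbf x]$-module is a finitely generated multigraded $A[\mathbf x]$-module all of whose components $M_d$ are free $A$-modules of finite rank. Filter-regularity: a multihomogeneous element $f\in R$ is filter-regular for a multigraded $R$-module $M$ if $(0:_Mf)=\{m\in M: fm=0\}$ is eventually zero. A sequence $(f_0,\dots,f_s)$ of multihomogeneous elements is a filter-regular sequence for $M$ if $f_i$ is filter-regular for $M/(f_0,\dots,f_{i-1})M$ for every $i$. For a multihomogeneous ideal $J\subseteq R$, $\operatorname{fgr}(J,M)\in\mathbb N\cup\{\infty\}$ is the supremum of the integers $s$ such that there is a filter-regular sequence $(g_0,\dots,g_{s-1})$ for $M$ with all $g_i\in J$. Relevant dimension and degree: for a Noetherian integral domain $A$ with fraction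 field $K$ and a finitely generated multigraded $A[\mathbf x]$-module $M$, there is a unique polynomial $H_M\in\mathbb Q[t_1,\dots,t_q]$ with $H_M(d)=\dim_K(M_d\otimes_AK)$ for $d$ large enough. $\operatorname{rdim}_A(M)$ is the total degree of $H_M$, or $-1$ if $H_M=0$. If $\operatorname{rdim}_A(M)\in\{0,-1\}$, then $H_M$ is a constant nonnegative integer and $\operatorname{rdeg}_A(M)$ is this integer. (Under the hypotheses of the claim, $\operatorname{rdim}_\kappa(N)\le 0$, so $\operatorname{rdeg}_\kappa(N)$ is defined.) Multigraded Koszul complex: for multihomogeneous $f_0,\dots,f_r\in R$ of multidegrees $d^{(0)},\dots,d^{(r)}$, $\mathbf K_\bullet(\underline f,M)$ has terms $\mathbf K_p=\bigwedge^p(R^{r+1})\otimes_RM$ ($0\le p\le r+1$, $R^{r+1}$ with basis $e_0,\dots,e_r$) and differentials $\partial_p(e_{i_1}\wedge\dots\wedge e_{i_p}\otimes m)=\sum_{s}(-1)^{s+1}f_{i_s}e_{i_1}\wedge\dots\wedge\widehat{e_{i_s}}\wedge\dots\wedge e_{i_p}\otimes m$; it is graded by giving $e_{i_1}\wedge\dots\wedge e_{i_p}\otimes m$ multidegree $d^{(i_1)}+\dots+d^{(i_p)}+\deg(m)$. $\mathbf K^\nu_\bullet(\underline f,M)$ is its component of multidegree $\nu$, a complex of $R_0$-modules. Cayley determinant: let $C_\bullet:0\to C_s\xrightarrow{d_s}\cdots\xrightarrow{d_1}C_0\to0$ be a complex of finite free $A$-modules that is generically exact (i.e. exact after $\otimes_AK$).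 Choose bases $b_i$ of the $C_i$ and partitions $b_i=b_i'\cup b_i''$ with $b_0''=b_s'=\emptyset$, such that in the block form $d_i=\begin{pmatrix}a_i&\phi_i\\ b_i&c_i\end{pmatrix}$ the block $\phi_i$ (from the span of $b_i''$ to the span of $b_{i-1}'$) is square with nonzero determinant. Then $\det_A(C_\bullet)=\prod_{i=1}^s\det(\phi_i)^{(-1)^{i+1}}\in K^\times/A^\times$, independent of choices. $M$-resultant: for $A$ a Noetherian UFD, $M$ componentwise free with $\operatorname{rdim}_A(M)=r$ and $\underline f=(f_0,\dots,f_r)$ filter-regular for $M$, the complex $\mathbf K^\nu_\bullet(\underline f,M)$ is generically exact for $\nu$ large enough and $\det_A(\mathbf K^\nu_\bullet(\underline f,M))$ is, for $\nu$ large enough, a fixed nonzero element of $A/A^\times$ (it equals the class of $\prod_\pi\pi^{\ell(((M/(\underline f)M)_\nu)_{(\pi)})}$, product over irreducible elements up to units, $\ell$ = length over $A_{(\pi)}$). This element is $\operatorname{Res}_A(\underline f,M)$. Order: with $\mathfrak m_{\mathfrak p}=\mathfrak pA_{\mathfrak p}$, $\operatorname{ord}_{\mathfrak p}(a)$ for $a\in A_{\mathfrak p}\setminus\{0\}$ is the integer $n$ with $a\in\mathfrak m_{\mathfrak p}^n\setminus\mathfrak m_{\mathfrak p}^{n+1}$, and $\operatorname{ord}_{\mathfrak p}(0)=+\infty$; for a class in $A/A^\times$ it is the order of any representative. *)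

(* Defs.v *)
From HB Require Import structures.
From mathcomp Require Import all_boot all_order all_algebra.
From mathcomp Require Import boolp classical_sets.
From mathcomp.multinomials Require Import freeg mpoly.

Set Implicit Arguments.
Unset Strict Implicit.
Unset Printing Implicit Defensive.

Import Order.TTheory GRing.Theory Num.Theory.

Local Open Scope ring_scope.
Local Open Scope quotient_scope.
Local Open Scope classical_set_scope.

Section Span.
Variables (R : nzRingType) (V : lmodType R) (S : set V).

Definition lspan : {pred V} := fun v =>
  `[< exists (k : nat) (c : 'I_k -> R) (u : 'I_k -> V),
        (forall i, S (u i)) /\ v = \sum_(i < k) c i *: u i >].

Fact lspan_submod_closed : submod_closed lspan.
Proof.
split; first by apply/asboolP; exists 0, (fun=> 0), (fun=> 0); split=> [[]//|]; rewrite big_ord0.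
move=> a x y /asboolP[k [c [u [Su ->]]]] /asboolP[l [d [v [Sv ->]]]].
apply/asboolP; exists (k + l)%N,
  (fun i => match split i with inl j => a * c j | inr j => d j end),
  (fun i => match split i with inl j => u j | inr j => v j end); split.
  by move=> i; case: split => j.
rewrite big_split_ord /= scaler_sumr; congr (_ + _).
  apply: eq_bigr => i _; rewrite scalerA.
  by case: (split _) (unsplitK (inl i : 'I_k + 'I_l)) => j /= [] // ->.
apply: eq_bigr => i _.
by case: (split _) (unsplitK (inr i : 'I_k + 'I_l)) => j /= [] // ->.
Qed.

HB.instance Definition _ :=
  GRing.isSubmodClosed.Build R V lspan lspan_submod_closed.

Lemma mem_lspan v : S v -> v \in lspan.
Proof.
move=> Sv; apply/asboolP; exists 1%N, (fun=> 1), (fun=> v); split=> //.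
by rewrite big_ord1 scale1r.
Qed.

Definition lquot : Type := Quotient.quot lspan.

HB.instance Definition _ := Choice.on lquot.
HB.instance Definition _ := EqQuotient.on lquot.
HB.instance Definition _ := GRing.Zmodule.on lquot.

Definition lquot_pi (v : V) : lquot := \pi_lquot v.

Lemma lquot_piP u v : (lquot_pi u = lquot_pi v) <-> (u - v \in lspan).
Proof.
split=> [/eqmodP|uv]; first by rewrite /Quotient.equiv.
by apply/eqmodP; rewrite /Quotient.equiv /=.
Qed.

Fact lquot_pi_is_zmod_morphism : zmod_morphism lquot_pi.
Proof. by move=> u v; rewrite /lquot_pi !piE. Qed.

HB.instance Definition _ :=
  GRing.isZmodMorphism.Build V lquot lquot_pi lquot_pi_is_zmod_morphism.

Lemma lquot_reprK (x : lquot) : lquot_pi (repr x) = x.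
Proof. exact: reprK. Qed.

Definition lquot_scale (a : R) (x : lquot) : lquot := lquot_pi (a *: repr x).

Fact lquot_scale_pi a v : lquot_scale a (lquot_pi v) = lquot_pi (a *: v).
Proof.
apply/lquot_piP; rewrite -scalerBr rpredZ //; apply/lquot_piP.
exact: lquot_reprK.
Qed.

Fact lquot_scaleA a b x :
  lquot_scale a (lquot_scale b x) = lquot_scale (a * b) x.
Proof. by rewrite -[x]lquot_reprK !lquot_scale_pi scalerA. Qed.

Fact lquot_scale1 : left_id 1 lquot_scale.
Proof. by move=> x; rewrite -[x]lquot_reprK lquot_scale_pi scale1r. Qed.

Fact lquot_scaleDr : right_distributive lquot_scale +%R.
Proof.
move=> a x y; rewrite -[x]lquot_reprK -[y]lquot_reprK -raddfD.
by rewrite !lquot_scale_pi scalerDr raddfD.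
Qed.

Fact lquot_scaleDl x : {morph lquot_scale^~ x : a b / a + b}.
Proof.
move=> a b; rewrite -[x]lquot_reprK !lquot_scale_pi.
by rewrite scalerDl raddfD.
Qed.

HB.instance Definition _ := GRing.Zmodule_isLmodule.Build R lquot
  lquot_scaleA lquot_scale1 lquot_scaleDr lquot_scaleDl.

Fact lquot_pi_is_scalable : scalable lquot_pi.
Proof. by move=> a v; rewrite -lquot_scale_pi. Qed.

HB.instance Definition _ :=
  GRing.isScalable.Build R V lquot *:%R lquot_pi lquot_pi_is_scalable.

Lemma lspan_ker (W : lmodType R) (L : {linear V -> W}) :
  (forall v, S v -> L v = 0) -> forall v, v \in lspan -> L v = 0.
Proof.
move=> LS v /asboolP[k [c [u [Su ->]]]]; rewrite raddf_sum big1 // => i _.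
by rewrite /= linearZ_LR LS /= ?scaler0 //.
Qed.

Lemma lquot_lift (W : lmodType R) (L : {linear V -> W}) :
  (forall v, S v -> L v = 0) -> forall v, L (repr (lquot_pi v)) = L v.
Proof.
move=> LS v; apply/eqP; rewrite -subr_eq0 -raddfB; apply/eqP.
apply: lspan_ker => //; apply/lquot_piP; exact: lquot_reprK.
Qed.

End Span.

Section FreeLift.
Variables (R : nzRingType) (K : choiceType) (W : lmodType R) (g : K -> W).

Fact fglift_is_zmod_morphism : zmod_morphism (fglift g).
Proof. exact: lift_is_additive. Qed.

HB.instance Definition _ := GRing.isZmodMorphism.Build
  {freeg K / R} W (fglift g) fglift_is_zmod_morphism.

Lemma fgZU (a b : R) (x : K) :
  a *: << b *g x >> = << a * b *g x >> :> {freeg K / R}.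
Proof. by apply/eqP/freeg_eqP=> y; rewrite coeffZ !coeffU mulrA. Qed.

Fact fglift_is_scalable : scalable (fglift g).
Proof.
move=> a; elim/freeg_ind_dom0 => [|b x D _ _ IH].
  by rewrite scaler0 raddf0 scaler0.
by rewrite scalerDr !raddfD /= IH fgZU !liftU scalerA.
Qed.

HB.instance Definition _ := GRing.isScalable.Build R
  {freeg K / R} W *:%R (fglift g) fglift_is_scalable.

End FreeLift.

(* The extension of scalars V (x)_A B along phi : A -> B, as the free B-module
   on V modulo the relations making v |-> v (x) 1 additive and phi-semilinear. *)
Section ExtendScalars.
Variables (A B : comNzRingType) (phi : {rmorphism A -> B}) (V : lmodType A).

Definition tens_rel : set {freeg V / B} := [set t |
  (exists u v : V, t = << u + v >> - << u >> - << v >>) \/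
  (exists (a : A) (u : V), t = << a *: u >> - phi a *: << u >>)].

Definition tens : Type := lquot tens_rel.

HB.instance Definition _ := GRing.Lmodule.on tens.

Definition tens1 (v : V) : tens := lquot_pi tens_rel << v >>.

Fact tens1_is_zmod_morphism : zmod_morphism tens1.
Proof.
have tens1D u v : tens1 (u + v) = tens1 u + tens1 v.
  rewrite /tens1 -raddfD; apply/lquot_piP/mem_lspan; left.
  by exists u, v; rewrite opprD addrA.
move=> u v; have := tens1D (u - v) v; rewrite subrK => ->.
by rewrite addrK.
Qed.

HB.instance Definition _ :=
  GRing.isZmodMorphism.Build V tens tens1 tens1_is_zmod_morphism.

Lemma tens1Z a v : tens1 (a *: v) = phi a *: tens1 v.
Proof.
rewrite /tens1 -linearZ; apply/lquot_piP/mem_lspan; right.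
by exists a, v.
Qed.

Lemma tens_ind (P : tens -> Prop) :
  P 0 -> (forall x y, P x -> P y -> P (x + y)) ->
  (forall b v, P (b *: tens1 v)) -> forall x, P x.
Proof.
move=> P0 PD P1 x; rewrite -[x]lquot_reprK.
elim/freeg_ind_dom0: (repr x) => [|b v D _ _ PDD]; first by rewrite raddf0.
rewrite raddfD; apply: PD => //.
by rewrite /= -[b]mulr1 -fgZU linearZ_LR; exact: P1.
Qed.

Lemma tens_ext (W : lmodType B) (L1 L2 : {linear tens -> W}) :
  (forall v, L1 (tens1 v) = L2 (tens1 v)) -> L1 =1 L2.
Proof.
move=> eqL x; elim/tens_ind: x => [|x y ex ey|b v]; first by rewrite !raddf0.
  by rewrite !raddfD /= ex ey.
by rewrite !linearZ_LR /= eqL.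
Qed.

Section Lift.
Variables (W : lmodType B) (g : V -> W).

Definition tens_lift (x : tens) : W := fglift g (repr x).

Hypothesis gD : {morph g : u v / u + v}.
Hypothesis gZ : forall a v, g (a *: v) = phi a *: g v.

Let fglift_rel D : tens_rel D -> fglift g D = 0.
Proof.
case=> [[u [v ->]]|[a [u ->]]]; rewrite !raddfB /= ?linearZ_LR /= !liftU !scale1r.
  by rewrite gD [g u + _]addrC addrK subrr.
by rewrite gZ scalerN subrr.
Qed.

Lemma tens_lift_pi D : tens_lift (lquot_pi tens_rel D) = fglift g D.
Proof. exact: (lquot_lift (L := fglift g) fglift_rel). Qed.

Lemma tens_lift1 v : tens_lift (tens1 v) = g v.
Proof. by rewrite tens_lift_pi liftU scale1r. Qed.

Lemma tens_lift_is_linear : linear tens_lift.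
Proof.
move=> b x y; rewrite -[x]lquot_reprK -[y]lquot_reprK -linearP /=.
by rewrite !tens_lift_pi linearP.
Qed.

End Lift.

End ExtendScalars.

(* An A[x]-module seen as an A-module. *)
Section CoefModule.
Variables (A : comNzRingType) (k : nat) (M : lmodType {mpoly A[k]}).

Definition coefmod : Type := M.

HB.instance Definition _ := GRing.Zmodule.on coefmod.

Definition coef_scale (a : A) (m : coefmod) : coefmod := a%:MP *: (m : M).

Fact coef_scaleA a b m : coef_scale a (coef_scale b m) = coef_scale (a * b) m.
Proof. by rewrite /coef_scale scalerA rmorphM. Qed.

Fact coef_scale1 : left_id 1 coef_scale.
Proof. by move=> m; rewrite /coef_scale scale1r. Qed.

Fact coef_scaleDr : right_distributive coef_scale +%R.
Proof. by move=> a m1 m2; rewrite /coef_scale scalerDr. Qed.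

Fact coef_scaleDl m : {morph coef_scale^~ m : a b / a + b}.
Proof. by move=> a b; rewrite /coef_scale rmorphD scalerDl. Qed.

HB.instance Definition _ := GRing.Zmodule_isLmodule.Build A coefmod
  coef_scaleA coef_scale1 coef_scaleDr coef_scaleDl.

End CoefModule.

(* The extension of scalars M (x)_A B of an A[x]-module M, with its structure of
   B[x]-module: b x^m acts by m' (x) c |-> x^m m' (x) b c. *)
Section ExtendPolyModule.
Variables (A B : comNzRingType) (phi : {rmorphism A -> B}) (k : nat).
Variable M : lmodType {mpoly A[k]}.

Definition ptens : Type := tens phi (coefmod M).

HB.instance Definition _ := GRing.Zmodule.on ptens.

Local Notation T := (tens phi (coefmod M)).

Definition ptens1 (m : M) : ptens := tens1 phi (m : coefmod M).

Definition ptens_scale_gen (F : {mpoly B[k]}) (m : coefmod M) : T :=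
  \sum_(e <- msupp F) F@_e *: tens1 phi ('X_[e] *: (m : M) : coefmod M).

Definition ptens_scale (F : {mpoly B[k]}) (t : ptens) : ptens :=
  tens_lift (ptens_scale_gen F) t.

Fact ptens_scale_genD F : {morph ptens_scale_gen F : u v / u + v}.
Proof.
move=> u v; rewrite /ptens_scale_gen -big_split; apply: eq_bigr => e _.
rewrite -[RHS]scalerDr -raddfD; congr (_ *: tens1 _ _); exact: (@scalerDr _ M).
Qed.

Fact ptens_scale_genZ F a m :
  ptens_scale_gen F (a *: m) = phi a *: ptens_scale_gen F m.
Proof.
rewrite /ptens_scale_gen scaler_sumr; apply: eq_bigr => e _.
rewrite [RHS]scalerA [phi a * _]mulrC -[RHS]scalerA -tens1Z; congr (_ *: tens1 _ _).
transitivity ('X_[e] *: (a%:MP *: (m : M))) => //.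
by rewrite scalerA mulrC -scalerA.
Qed.

Lemma ptens_scale1E F m : ptens_scale F (ptens1 m) = ptens_scale_gen F m.
Proof. exact: (tens_lift1 (ptens_scale_genD F) (ptens_scale_genZ F)). Qed.

Lemma ptens_scaleZ1 F b m :
  ptens_scale F (b *: tens1 phi m : T) = b *: ptens_scale_gen F m.
Proof.
have L := tens_lift_is_linear (ptens_scale_genD F) (ptens_scale_genZ F).
have L0 : tens_lift (ptens_scale_gen F) (0 : T) = 0.
  by have := L (-1) 0 0; rewrite scaler0 addr0 scaleN1r addNr.
have := L b (tens1 phi m) 0; rewrite addr0 L0 addr0 /ptens_scale => ->.
by rewrite -(ptens_scale1E F m).
Qed.

Fact ptens_scaleDr : right_distributive ptens_scale +%R.
Proof.
move=> F x y.
have := tens_lift_is_linear (ptens_scale_genD F) (ptens_scale_genZ F) 1 x y.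
by rewrite !scale1r.
Qed.

Fact ptens_scale0 F : ptens_scale F 0 = 0.
Proof. by apply: (addIr (ptens_scale F 0)); rewrite -ptens_scaleDr !add0r. Qed.

Let gen_sum (F : {mpoly B[k]}) (m : coefmod M) (s : seq 'X_{1..k}) :
  uniq s -> {subset msupp F <= s} -> ptens_scale_gen F m =
  \sum_(e <- s) F@_e *: tens1 phi ('X_[e] *: (m : M) : coefmod M).
Proof.
move=> s_uniq subs; rewrite [RHS](bigID (mem (msupp F))) /=.
rewrite [X in _ = _ + X]big1 ?addr0; last first.
  by move=> e /memN_msupp_eq0 ->; rewrite scale0r.
rewrite -[RHS]big_filter; apply: perm_big; apply: uniq_perm.
- exact: msupp_uniq.
- exact: filter_uniq.
by move=> e; rewrite mem_filter andbC; case: (boolP (e \in s)) => //= /(contra (subs e))/negPf.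
Qed.

Fact ptens_scale_gen_linear m b F G :
  ptens_scale_gen (b *: F + G) m = b *: ptens_scale_gen F m + ptens_scale_gen G m.
Proof.
pose s := undup (msupp F ++ msupp G ++ msupp (b *: F + G)).
have s_uniq : uniq s by exact: undup_uniq.
rewrite !(@gen_sum _ _ s) //.
- rewrite scaler_sumr -big_split; apply: eq_bigr => e _ /=.
  by rewrite mcoeffD mcoeffZ scalerDl scalerA.
all: by move=> e; rewrite mem_undup !mem_cat => ->; rewrite ?orbT.
Qed.

Fact ptens_scale_gen0 m : ptens_scale_gen 0 m = 0.
Proof. by rewrite /ptens_scale_gen msupp0 big_nil. Qed.

Lemma ptens_scale_linear x b F G : ptens_scale (b *: F + G) x =
  (b *: (ptens_scale F x : T) + (ptens_scale G x : T) : T).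
Proof.
elim/tens_ind: x => [|x y IHx IHy|c m].
- by rewrite !ptens_scale0 scaler0 addr0.
- by rewrite !ptens_scaleDr IHx IHy scalerDr addrACA.
rewrite !ptens_scaleZ1 ptens_scale_gen_linear scalerDr !scalerA.
by rewrite [c * b]mulrC.
Qed.

Lemma ptens_scaleX1 e c m :
  ptens_scale 'X_[e] (c *: tens1 phi m : T) =
  (c *: tens1 phi ('X_[e] *: (m : M) : coefmod M) : T).
Proof.
by rewrite ptens_scaleZ1 /ptens_scale_gen msuppX big_seq1 mcoeffX eqxx scale1r.
Qed.

Fact ptens_scaleDl x : {morph ptens_scale^~ x : F G / F + G}.
Proof.
by move=> F G; have := ptens_scale_linear x 1 F G; rewrite !scale1r.
Qed.

Fact ptens_scale1 : left_id 1 ptens_scale.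
Proof.
move=> x; rewrite -mpolyX0; elim/tens_ind: x => [|x y IHx IHy|c m].
- exact: ptens_scale0.
- by rewrite ptens_scaleDr IHx IHy.
by rewrite ptens_scaleX1 mpolyX0 scale1r.
Qed.

Fact ptens_scale0l x : ptens_scale 0 x = 0.
Proof. by apply: (addIr (ptens_scale 0 x)); rewrite -ptens_scaleDl !add0r. Qed.

Fact ptens_scaleZr F b (x : T) :
  ptens_scale F (b *: x : T) = (b *: (ptens_scale F x : T) : T).
Proof.
have := tens_lift_is_linear (ptens_scale_genD F) (ptens_scale_genZ F) b x 0.
rewrite addr0 => e; rewrite [LHS]e -[RHS]addr0; congr (_ + _).
exact: (ptens_scale0 F).
Qed.

Fact ptens_scaleA F G x :
  ptens_scale F (ptens_scale G x) = ptens_scale (F * G) x.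
Proof.
elim/mpolyind: F => [|b e F _ _ IHF]; first by rewrite mul0r !ptens_scale0l.
rewrite mulrDl -scalerAl !ptens_scale_linear IHF; congr (_ *: _ + _).
elim/mpolyind: G {IHF} => [|c e' G _ _ IHG].
  by rewrite mulr0 !ptens_scale0l ptens_scale0.
rewrite mulrDr -scalerAr !ptens_scale_linear ptens_scaleDr ptens_scaleZr IHG.
congr (_ *: _ + _).
elim/tens_ind: x {IHG} => [|x y IHx IHy|d m]; first by rewrite !ptens_scale0.
  by rewrite !ptens_scaleDr IHx IHy.
by rewrite -mpolyXD !ptens_scaleX1 mpolyXD scalerA.
Qed.

HB.instance Definition _ := GRing.Zmodule_isLmodule.Build {mpoly B[k]} ptens
  ptens_scaleA ptens_scale1 ptens_scaleDr ptens_scaleDl.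

End ExtendPolyModule.

(* The localization A_p of a domain at a prime ideal p, inside the fraction
   field of A, and its residue field. *)
Section Localization.
Variables (A : idomainType) (p : prime_idealr A).

Definition loc_pred : {pred {fraction A}} := fun x =>
  `[< exists a s : A, s \notin p /\ x = tofrac a / tofrac s >].

Fact prime_neq0 s : s \notin p -> tofrac s != 0.
Proof. by apply: contra; rewrite tofrac_eq0 => /eqP->; exact: idealr0. Qed.

Fact primeM s t : s \notin p -> t \notin p -> s * t \notin p.
Proof. by move=> sp tp; rewrite prime_idealrM negb_or sp. Qed.

Fact loc_subring_closed : subring_closed loc_pred.
Proof.
split.
- apply/asboolP; exists 1, 1; rewrite idealr1; split=> //.
  by rewrite divff // tofrac_eq0 oner_eq0.
- move=> _ _ /asboolP[a [s [sp ->]]] /asboolP[b [t [tp ->]]].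
  apply/asboolP; exists (a * t - b * s), (s * t); split; first exact: primeM.
  rewrite -mulNr addf_div ?prime_neq0 // rmorphB !rmorphM /=.
  by rewrite mulNr.
move=> _ _ /asboolP[a [s [sp ->]]] /asboolP[b [t [tp ->]]].
apply/asboolP; exists (a * b), (s * t); split; first exact: primeM.
by rewrite !rmorphM mulf_div.
Qed.

HB.instance Definition _ :=
  GRing.isSubringClosed.Build {fraction A} loc_pred loc_subring_closed.

Record localization : Type :=
  Localization { loc_val : {fraction A}; _ : loc_val \in loc_pred }.

HB.instance Definition _ := [isSub for loc_val].
HB.instance Definition _ := [Choice of localization by <:].
HB.instance Definition _ := [SubChoice_isSubComNzRing of localization by <:].

Fact loc_frac_subproof a : tofrac a \in loc_pred.
Proof.
apply/asboolP; exists a, 1; rewrite idealr1; split=> //.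
by rewrite rmorph1 divr1.
Qed.

Definition to_loc (a : A) : localization := Localization (loc_frac_subproof a).

Fact to_loc_is_zmod_morphism : zmod_morphism to_loc.
Proof. by move=> a b; apply: val_inj; rewrite /= rmorphB. Qed.

Fact to_loc_is_monoid_morphism : monoid_morphism to_loc.
Proof.
by split=> [|a b]; apply: val_inj; rewrite /= ?rmorph1 // rmorphM.
Qed.

HB.instance Definition _ :=
  GRing.isZmodMorphism.Build A localization to_loc to_loc_is_zmod_morphism.
HB.instance Definition _ :=
  GRing.isMonoidMorphism.Build A localization to_loc to_loc_is_monoid_morphism.

(* p A_p *)
Definition loc_max : {pred localization} := fun x =>
  `[< exists a s : A,
        [/\ a \in p, s \notin p & loc_val x = tofrac a / tofrac s] >].

Lemma loc_maxE a s (x : localization) : s \notin p ->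
  loc_val x = tofrac a / tofrac s -> (x \in loc_max) = (a \in p).
Proof.
move=> sp xE; apply/idP/idP => [/asboolP[b [t [bp tp]]]|ap]; last first.
  by apply/asboolP; exists a, s.
rewrite xE => /eqP; rewrite eqr_div ?prime_neq0 // -!rmorphM tofrac_eq.
move=> /eqP ats; have : a * t \in p by rewrite ats mulrC idealMr.
by rewrite prime_idealrM (negPf tp) orbF.
Qed.

Fact loc_max_idealr_closed : idealr_closed loc_max.
Proof.
have one_p : 1 \notin p by rewrite idealr1.
split.
- rewrite (@loc_maxE 0 1) ?idealr0 //=.
  by rewrite rmorph0 mul0r.
- rewrite (@loc_maxE 1 1) // /=.
  by rewrite rmorph1 divr1.
move=> x u v /asboolP[a [s [ap sp uE]]] /asboolP[b [t [bp tp vE]]].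
have /asboolP[c [w [wp xE]]] := valP x.
apply/asboolP; exists (c * a * t + b * (w * s)), (w * s * t); split.
- by apply: rpredD; [rewrite mulrAC | rewrite mulrC]; exact: idealMr.
- by rewrite !primeM.
rewrite /= uE vE; move: xE => /= ->.
by rewrite mulf_div -!rmorphM addf_div ?prime_neq0 ?primeM // -!rmorphM -rmorphD.
Qed.

HB.instance Definition _ :=
  isIdealr.Build localization loc_max loc_max_idealr_closed.

Definition residue_field : Type := {ideal_quot loc_max}.

HB.instance Definition _ := GRing.ComNzRing.on residue_field.

Definition loc_residue (x : localization) : residue_field := \pi_residue_field x.

Fact loc_residue_is_zmod_morphism : zmod_morphism loc_residue.
Proof. by move=> x y; rewrite /loc_residue !piE. Qed.

Fact loc_residue_is_monoid_morphism : monoid_morphism loc_residue.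
Proof. by split=> [|x y]; rewrite /loc_residue !piE. Qed.

HB.instance Definition _ := GRing.isZmodMorphism.Build
  localization residue_field loc_residue loc_residue_is_zmod_morphism.
HB.instance Definition _ := GRing.isMonoidMorphism.Build
  localization residue_field loc_residue loc_residue_is_monoid_morphism.

Lemma loc_residue_eq0 x : (loc_residue x == 0) = (x \in loc_max).
Proof.
rewrite -(rmorph0 loc_residue) /=.
by rewrite /loc_residue -Quotient.idealrBE subr0.
Qed.

Definition residue_inv (x : residue_field) : residue_field :=
  xget 0 [set y | y * x = 1].

Fact residue_mulVf x : x != 0 -> residue_inv x * x = 1.
Proof.
move=> x_neq0; rewrite /residue_inv; case: xgetP => [y _ //|].
have [z xE] : exists z, x = loc_residue z.
  by exists (repr x); rewrite /loc_residue reprK.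
move: x_neq0; rewrite {x}xE loc_residue_eq0.
have /asboolP[a [s [sp zE]]] := valP z; rewrite (loc_maxE sp zE) => ap.
have wP : tofrac s / tofrac a \in loc_pred by apply/asboolP; exists s, a.
move=> /(_ (loc_residue (Localization wP)))[]; rewrite /= -rmorphM.
rewrite (_ : _ * z = 1) ?rmorph1 //; apply: val_inj => /=; rewrite zE.
by rewrite mulf_div [tofrac a * _]mulrC divff // mulf_neq0 ?prime_neq0.
Qed.

Fact residue_inv0 : residue_inv 0 = 0.
Proof.
rewrite /residue_inv; case: xgetP => // y _ /esym/eqP.
by rewrite mulr0 oner_eq0.
Qed.

HB.instance Definition _ :=
  GRing.ComNzRing_isField.Build residue_field residue_mulVf residue_inv0.

Definition residue (a : A) : residue_field := loc_residue (to_loc a).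

HB.instance Definition _ := GRing.RMorphism.copy residue (loc_residue \o to_loc).

End Localization.

Section Rings.
Variable R : comNzRingType.

Definition is_ideal (I : set R) : Prop :=
  I 0 /\ forall a x y, I x -> I y -> I (a * x + y).

Definition noetherian : Prop := forall I : set R, is_ideal I ->
  exists (k : nat) (g : 'I_k -> R),
    forall x, I x <-> exists c : 'I_k -> R, x = \sum_(i < k) c i * g i.

Definition ideal_gen (s : seq R) : set R :=
  [set x | exists c : 'I_(size s) -> R, x = \sum_(i < size s) c i * s`_i].

(* ideal_pow I 0 is the unit ideal. *)
Fixpoint ideal_pow (I : set R) (n : nat) : set R :=
  if n is n'.+1 then
    [set x | exists (k : nat) (u v : 'I_k -> R),
       (forall i, I (u i) /\ ideal_pow I n' (v i)) /\
       x = \sum_(i < k) u i * v i]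
  else setT.

End Rings.

Section UFD.
Variable A : idomainType.

Definition associated (a b : A) : Prop :=
  exists2 u, u \is a GRing.unit & b = u * a.

Definition irreducible_elt (a : A) : Prop :=
  [/\ a != 0, a \isn't a GRing.unit
    & forall b c, a = b * c -> b \is a GRing.unit \/ c \is a GRing.unit].

Definition factorization (a : A) (s : seq A) : Prop :=
  {in s, forall x, irreducible_elt x} /\ associated (\prod_(x <- s) x) a.

Definition is_UFD : Prop :=
  (forall a, a != 0 -> exists s, factorization a s) /\
  (forall a s t, a != 0 -> factorization a s -> factorization a t ->
     exists t', [/\ perm_eq t t', size s = size t'
       & forall i, (i < size s)%N -> associated s`_i t'`_i]).

End UFD.

(* Elements of N u {oo}, with None standing for oo. *)
Definition enat := option nat.

Definition le_enat (k : nat) (e : enat) : bool :=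
  if e is Some n then (k <= n)%N else true.

(* The supremum of a nonempty set of natural numbers. *)
Definition enat_sup (S : set nat) : enat := xget None [set e : enat |
  if e is Some n then S n /\ forall k, S k -> (k <= n)%N
  else forall n, exists2 k, S k & (n < k)%N].

(* None for a = 0; for A Noetherian and a != 0, Krull's intersection theorem
   provides the integer n. *)
Definition ord_at (A : idomainType) (p : prime_idealr A)
    (a : localization p) : enat :=
  let m : set (localization p) := [set x | x \in @loc_max A p] in
  xget None [set e : enat | exists2 n, e = Some n &
    ideal_pow m n a /\ ~ ideal_pow m n.+1 a].

Section Bases.
Variables (A : comNzRingType) (V : lmodType A).

(* b is a basis of the submodule S of V *)
Definition is_basis (S : set V) (k : nat) (b : 'I_k -> V) : Prop :=
  (forall i, S (b i)) /\
  (forall v, S v -> exists! c : 'rV[A]_k, v = \sum_(i < k) c 0 i *: b i).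

End Bases.

Section CayleyDeterminant.
Variables (A : idomainType) (V : lmodType A).

(* cayley_det C D s delta : delta represents, in K^* / A^*, the determinant of
   the complex 0 -> C s -> ... -> C 0 -> 0 of submodules of V with differential
   D.  The basis b i of C i lists first b_i' (m i.+1 elements), then b_i''
   (m i elements); d i is the matrix, acting on columns, of D : C i.+1 -> C i,
   and ursubmx (d i) is the block phi_(i+1) from the span of b_(i+1)'' to the
   span of b_i'. *)
Definition cayley_det (C : nat -> set V) (D : V -> V) (s : nat)
    (delta : {fraction A}) : Prop :=
  exists (m : nat -> nat) (b : forall i, 'I_(m i.+1 + m i) -> V)
         (d : forall i, 'M[A]_(m i.+1 + m i, m i.+2 + m i.+1)),
  [/\ m 0%N = 0%N /\ m s.+1 = 0%N,
      forall i, (i <= s)%N -> is_basis (C i) (b i),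
      forall i, (i < s)%N ->
        forall j, D (b i.+1 j) = \sum_l d i l j *: b i l,
      forall i, (i < s)%N -> \det (ursubmx (d i)) != 0
    & exists2 u : A, u \is a GRing.unit &
        delta = tofrac u *
          \prod_(i < s) tofrac (\det (ursubmx (d i))) ^ ((-1) ^+ i : int)].

End CayleyDeterminant.

Section Multigraded.
Variables (q : nat) (n : 'I_q -> nat).

Definition eventually (P : 'X_{1..q} -> Prop) : Prop :=
  exists d0, forall d, (d0 <= d)%MM -> P d.

(* The variables x_(p,i), 0 <= i <= n p, are numbered by enum_rank. *)
Definition nvars : nat := #|{: {p : 'I_q & 'I_(n p).+1}}|.

Definition multideg (e : 'X_{1..nvars}) : 'X_{1..q} :=
  [multinom (\sum_(k < nvars | tag (enum_val k) == p) e k)%N | p < q].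

Definition multihomog (A : comNzRingType) (d : 'X_{1..q})
    (f : {mpoly A[nvars]}) : Prop :=
  {in msupp f, forall e, multideg e = d}.

(* An A[x]-module with a family of subsets M_d, required to be a multigrading
   by is_multigraded. *)
Record mgmod (A : comNzRingType) := MGMod {
  mg_sort :> lmodType {mpoly A[nvars]};
  mg_comp : 'X_{1..q} -> set mg_sort }.

Definition is_multigraded (A : comNzRingType) (M : mgmod A) : Prop :=
  [/\ forall d, mg_comp (m := M) d 0 /\
        (forall x y, mg_comp d x -> mg_comp d y -> mg_comp (m := M) d (x - y)),
      forall d e f (x : M), multihomog d f -> mg_comp e x ->
        mg_comp (d + e)%MM (f *: x),
      forall x : M, exists (s : seq 'X_{1..q}) (c : 'X_{1..q} -> M),
        (forall d, mg_comp d (c d)) /\ x = \sum_(d <- s) c d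
    & forall (s : seq 'X_{1..q}) (c : 'X_{1..q} -> M), uniq s ->
        (forall d, mg_comp d (c d)) -> \sum_(d <- s) c d = 0 ->
        {in s, forall d, c d = 0}].

Definition finitely_generated (A : comNzRingType) (M : mgmod A) : Prop :=
  exists (k : nat) (g : 'I_k -> M), forall x : M,
    exists c : 'I_k -> {mpoly A[nvars]}, x = \sum_(i < k) c i *: g i.

Definition componentwise_free (A : comNzRingType) (M : mgmod A) : Prop :=
  [/\ is_multigraded M, finitely_generated M
    & forall d, exists (k : nat) (b : 'I_k -> coefmod M),
        is_basis (mg_comp d : set (coefmod M)) b].

(* M / (s) M *)
Definition mg_quot (A : comNzRingType) (M : mgmod A)
    (s : seq {mpoly A[nvars]}) : mgmod A :=
  let S := [set x : M | exists2 f, f \in s & exists y : M, x = f *: y] in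
  MGMod (fun d => [set x : lquot S | exists2 y, mg_comp d y & x = lquot_pi S y]).

(* M (x)_A B; its component of degree d is the B-submodule spanned by the
   y (x) 1, y in M_d, i.e. the (isomorphic) image of M_d (x)_A B. *)
Definition mg_extend (A B : comNzRingType) (phi : {rmorphism A -> B})
    (M : mgmod A) : mgmod B :=
  MGMod (fun d => [set t : ptens phi M |
    (t : tens phi (coefmod M)) \in lspan [set u : tens phi (coefmod M) |
      exists2 y : M, mg_comp d y & u = ptens1 phi y]]).

Definition filter_regular (A : comNzRingType) (f : {mpoly A[nvars]})
    (M : mgmod A) : Prop :=
  eventually (fun d => forall x : M, mg_comp d x -> f *: x = 0 -> x = 0).

Definition filter_regular_seq (A : comNzRingType) (s : seq {mpoly A[nvars]})
    (M : mgmod A) : Prop :=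
  forall i, (i < size s)%N ->
    (exists d, multihomog d s`_i) /\
    filter_regular s`_i (mg_quot M (take i s)).

Definition fgr (A : comNzRingType) (J : set {mpoly A[nvars]})
    (M : mgmod A) : enat :=
  enat_sup [set k | exists s : seq {mpoly A[nvars]},
    [/\ size s = k, {in s, forall g, J g} & filter_regular_seq s M]].

Section RelevantDimension.
Variables (A : idomainType) (M : mgmod A).

Definition is_hilbert_poly (H : {mpoly rat[q]}) : Prop :=
  let MK := mg_extend (@tofrac A) M in
  eventually (fun d => exists (k : nat) (b : 'I_k -> coefmod MK),
    is_basis (mg_comp d : set (coefmod MK)) b /\
    H.@[fun p => (d p)%:R] = k%:R).

(* Such a polynomial exists and is unique when A is Noetherian and M is a
   finitely generated multigraded module. *)
Definition hilbert_poly : {mpoly rat[q]} :=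
  xget 0 [set H | is_hilbert_poly H].

(* msize is the total degree plus one, and msize 0 = 0 *)
Definition rdim : int := (msize hilbert_poly)%:Z - 1.

(* Meaningful only when rdim is 0 or -1. *)
Definition rdeg : nat := xget 0%N [set k : nat | hilbert_poly = k%:R].

End RelevantDimension.

(* The Koszul complex: K_p is the module of functions c supported on the
   subsets of cardinality p, standing for the sum over I of e_I (x) c I with
   e_I the exterior product of the e_i, i in I, in increasing order. *)
Section Koszul.
Variables (A : comNzRingType) (M : mgmod A) (k : nat).
Variables (f : 'I_k -> {mpoly A[nvars]}) (d : 'I_k -> 'X_{1..q}).

Local Notation koszul_mod := {ffun {set 'I_k} -> coefmod M}.

Definition koszul_diff (c : koszul_mod) : koszul_mod :=
  [ffun J : {set 'I_k} => \sum_(i | i \notin J)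
     ((-1) ^+ #|[pred j in J | (j < i)%N]| * f i) *: (c (i |: J)%SET : M)].

Definition koszul_comp (nu : 'X_{1..q}) (p : nat) : set koszul_mod :=
  [set c : koszul_mod | forall I : {set 'I_k},
     let dI := (\sum_(i in I) d i)%MM in
     if (#|I| == p) && (dI <= nu)%MM then mg_comp (nu - dI)%MM (c I : M)
     else c I = 0].

End Koszul.

(* The representatives in A of the M-resultant of f_0, ..., f_r, where f_i has
   multidegree d i. *)
Definition mresultant (A : idomainType) (M : mgmod A) (r : nat)
    (f : (r.+1).-tuple {mpoly A[nvars]}) (d : 'I_r.+1 -> 'X_{1..q}) : set A :=
  [set rho : A | rho != 0 /\ eventually (fun nu =>
     cayley_det (koszul_comp (M := M) d nu) (koszul_diff (M := M) (tnth f)) r.+1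
       (tofrac rho))].

End Multigraded.

(* Main.v *)
Require Import Defs.
From HB Require Import structures.
From mathcomp Require Import all_boot all_order all_algebra.
From mathcomp Require Import boolp classical_sets.
From mathcomp Require Import ring zify.
From mathcomp.multinomials Require Import freeg mpoly.

Set Implicit Arguments.
Unset Strict Implicit.
Unset Printing Implicit Defensive.

Import Order.TTheory GRing.Theory Num.Theory.

Local Open Scope ring_scope.

(* Only the order of a determinant has to be bounded, so the choices hidden in
   the Cayley determinant are changed to suit p.  Since (pi(f)) contains a
   filter-regular sequence of length r for Mbar, the Koszul complex of pi(f) on
   Mbar has, in large degree nu, homology in degrees 0 and 1 only.  Hence the
   reductions mod p of the differentials of K^nu(f, M), except the first one,
   have the same rank as over the fraction field, and the complementary bases
   can be chosen so that all the blocks phi_i except phi_1 are invertible at p.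
   The determinant is then det(phi_1) up to a unit of A_p, and phi_1 mod p has
   corank at least dim N_nu = rdeg N, so det(phi_1) lies in p^(rdeg N) A_p. *)

(** The bases that come with the Cayley determinant are adapted to the fraction field only: modulo p
    any block may degenerate, and as every other block enters with exponent -1, the factors cannot
    be estimated one at a time. This forces the change of complementary vectors, carried out on
    determinants over A; the denominators that appear lie outside p and become units of A_p. For
    exactness modulo p the obstacle is that the filter-regular sequence consists of combinations g
    of the pi(f_i), with coefficients a_i that need not be multihomogeneous. Exterior multiplication
    by the sum of the a_i e_i is a homotopy for multiplication by g, and it is cut down to one
    multidegree by the projections of the grading. The Koszul complex vanishes above degree r + 1,
    and each of the r elements of the sequence lowers by one the degree above which homology
    vanishes; this leaves degrees 0 and 1. *)

(** * Powers of an ideal *)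

Section IdealPow.
Variables (R : comNzRingType) (I : set R).

Lemma ideal_pow0 n : ideal_pow I n 0.
Proof.
case: n => [//|n]; exists 0%N, (fun=> 0), (fun=> 0); split=> [[]|] //.
by rewrite big_ord0.
Qed.

Lemma ideal_powD n x y : ideal_pow I n x -> ideal_pow I n y -> ideal_pow I n (x + y).
Proof.
case: n => [//|n] [k [u [v [uv ->]]]] [l [w [z [wz ->]]]].
exists (k + l)%N, (fun i => match split i with inl j => u j | inr j => w j end),
  (fun i => match split i with inl j => v j | inr j => z j end); split.
  by move=> i; case: split => j.
rewrite big_split_ord /=; congr (_ + _); apply: eq_bigr => i _.
  by case: (split _) (unsplitK (inl i : 'I_k + 'I_l)) => j /= [] // ->.
by case: (split _) (unsplitK (inr i : 'I_k + 'I_l)) => j /= [] // ->.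
Qed.

Lemma ideal_pow_mulr n a x : ideal_pow I n x -> ideal_pow I n (a * x).
Proof.
elim: n a x => [//|n IHn] a x [k [u [v [uv ->]]]].
exists k, u, (fun i => a * v i); split=> [i|].
  by have [? ?] := uv i; split=> //; exact: IHn.
by rewrite mulr_sumr; apply: eq_bigr => i _; rewrite mulrCA.
Qed.

Lemma ideal_powS n x y : I x -> ideal_pow I n y -> ideal_pow I n.+1 (x * y).
Proof.
by move=> Ix Iy; exists 1%N, (fun=> x), (fun=> y); split=> //; rewrite big_ord1.
Qed.

Lemma ideal_pow_sum n (J : finType) (F : J -> R) :
  (forall j, ideal_pow I n (F j)) -> ideal_pow I n (\sum_j F j).
Proof.
move=> IF; elim/big_ind: _ => //; first exact: ideal_pow0.
exact: ideal_powD.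
Qed.

Lemma ideal_pow_le m n x : (m <= n)%N -> ideal_pow I n x -> ideal_pow I m x.
Proof.
elim: m n x => [//|m IHm] [//|n] x lemn [k [u [v [uv ->]]]].
by exists k, u, v; split=> // i; have [? /(IHm _ _ lemn)] := uv i.
Qed.

Lemma ideal_pow_prod (J : Type) (s : seq J) (P : pred J) (F : J -> R) :
  (forall j, P j -> I (F j)) -> ideal_pow I (count P s) (\prod_(j <- s) F j).
Proof.
move=> PI; elim: s => [//|j s IHs]; rewrite big_cons /=.
case: (boolP (P j)) => Pj; first by apply: ideal_powS => //; exact: PI.
exact: ideal_pow_mulr.
Qed.

End IdealPow.

(** * Lifting from the residue field to A, and the order of a determinant at p *)

Section Residue.
Variables (A : idomainType) (p : prime_idealr A).

Lemma residue_eq0 a : (residue p a == 0) = (a \in p).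
Proof.
rewrite loc_residue_eq0 (@loc_maxE _ _ a 1) ?idealr1 //=.
by rewrite rmorph1 divr1.
Qed.

Lemma residue_neq0 a : (residue p a != 0) = (a \notin p).
Proof. by rewrite residue_eq0. Qed.

(** The residue field is that of A_p, so it is reached from A only up to a denominator, here [t]. *)
Lemma residue_lift (x : residue_field p) :
  exists a t, t \notin p /\ residue p t * x = residue p a.
Proof.
have [z ->] : exists z, x = loc_residue z.
  by exists (repr x); rewrite /loc_residue reprK.
have /asboolP[a [t [tp zE]]] := valP z; exists a, t; split=> //.
rewrite /residue /= -rmorphM; congr loc_residue; apply: val_inj => /=.
by rewrite zE mulrC divfK // (prime_neq0 tp).
Qed.

Lemma prime_prod (J : finType) (P : pred J) (F : J -> A) :
  (forall j, P j -> F j \notin p) -> \prod_(j | P j) F j \notin p.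
Proof.
by move=> FP; elim/big_ind: _ => //; [rewrite idealr1 | exact: primeM].
Qed.

Lemma residue_lift_fun (J : finType) (F : J -> residue_field p) :
  exists (t : A) (G : J -> A), t \notin p /\
    forall j, residue p (G j) = residue p t * F j.
Proof.
have /choice[G GP] : forall j, exists x : A * A,
    x.2 \notin p /\ residue p x.2 * F j = residue p x.1.
  by move=> j; have [a [t ?]] := residue_lift (F j); exists (a, t).
exists (\prod_j (G j).2), (fun j => (G j).1 * \prod_(i | i != j) (G i).2).
split=> [|j]; first by apply: prime_prod => j _; case: (GP j).
have [_ GjE] := GP j.
by rewrite [in RHS](bigD1 j) //= rmorphM [in RHS]rmorphM /= -GjE mulrAC.
Qed.

Lemma residue_lift_mx (k l : nat) (X : 'M[residue_field p]_(k, l)) :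
  exists (t : A) (Y : 'M[A]_(k, l)), t \notin p /\
    map_mx (residue p) Y = residue p t *: X.
Proof.
have [t [G [tp GE]]] := residue_lift_fun (fun ij : 'I_k * 'I_l => X ij.1 ij.2).
exists t, (\matrix_(i, j) G (i, j)); split=> //.
by apply/matrixP=> i j; rewrite !mxE GE.
Qed.

Let m : set (localization p) := [set x | x \in @loc_max A p]%classic.

(** An element outside p is invertible in A_p; this is how all auxiliary factors outside p are
    discarded. *)
Lemma ideal_pow_to_loc k s a : s \notin p ->
  ideal_pow m k (to_loc p (s * a)) -> ideal_pow m k (to_loc p a).
Proof.
move=> sp; rewrite rmorphM /= => sa.
have sVP : (tofrac s)^-1 \in loc_pred p.
  by apply/asboolP; exists 1, s; rewrite rmorph1 div1r.
suff -> : to_loc p a = Localization sVP * (to_loc p s * to_loc p a).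
  exact: ideal_pow_mulr.
by apply: val_inj; rewrite /= mulrA mulVf ?mul1r // (prime_neq0 sp).
Qed.

Lemma to_loc_max a : a \in p -> m (to_loc p a).
Proof.
move=> ap; rewrite /m /= (@loc_maxE _ _ a 1) ?idealr1 //=.
by rewrite rmorph1 divr1.
Qed.

Lemma ideal_pow_det k n (X : 'M[A]_n) :
  (\rank (map_mx (residue p) X) + k <= n)%N ->
  ideal_pow m k (to_loc p (\det X)).
Proof.
set Xb := map_mx _ X => rkX.
(* [Q] lifts, up to the scalar [t], the row operations that reduce [Xb] to [pid_mx] times an
   invertible matrix. *)
have [t [Q [tp QE]]] := residue_lift_mx (invmx (col_ebase Xb)).
have Qp : \det Q \notin p.
  rewrite -residue_neq0 -det_map_mx QE detZ mulf_neq0 ?expf_neq0 ?residue_neq0 //.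
  by rewrite -unitfE -unitmxE unitmx_inv col_ebase_unit.
apply: (ideal_pow_to_loc Qp); rewrite -det_mulmx.
have QXp (i j : 'I_n) : (\rank Xb <= i)%N -> (Q *m X) i j \in p.
  move=> lei; rewrite -residue_eq0.
  have -> : residue p ((Q *m X) i j) = (map_mx (residue p) (Q *m X)) i j by rewrite [RHS]mxE.
  rewrite map_mxM QE -scalemxAl -/Xb -{2}(mulmx_ebase Xb) -!mulmxA.
  rewrite mulKmx ?col_ebase_unit // mxE mxE big1 ?mulr0 // => l _.
  by rewrite mxE [(i < _)%N]ltnNge lei andbF mul0r.
rewrite rmorph_sum; apply: ideal_pow_sum => s.
rewrite rmorphM; apply: ideal_pow_mulr; rewrite rmorph_prod.
(* The rows of [Q *m X] whose entries all lie in p; there are n minus the rank of [Xb] of them. *)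
pose P := [pred i : 'I_n | \rank Xb <= i]%N.
apply: (@ideal_pow_le _ _ _ (count P (index_enum 'I_n))); last first.
  by apply: ideal_pow_prod => i Pi; apply/to_loc_max/QXp.
rewrite -sum1_count /= -(@big_mkord _ _ _ n [pred i | \rank Xb <= i]%N (fun=> 1%N)).
have rn : (\rank Xb <= n)%N := leq_trans (leq_addr _ _) rkX.
rewrite (@big_cat_nat _ _ _ (\rank Xb)) //= [X in (_ <= _ + X)%N]big_nat_cond.
rewrite [X in (_ <= _ + X)%N](eq_bigl (fun i => (\rank Xb <= i < n)%N)); last first.
  by move=> i; rewrite /= andb_idr // => /andP[].
by rewrite -big_nat sum_nat_const_nat muln1; lia.
Qed.

End Residue.

(* Modulo the columns of F, which D kills, T' is T times a square matrix Y, and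
   both sides of the identity pick up the factor det Y. *)
Lemma det_exchange (K : fieldType) (a b c : nat) (D : 'M[K]_(a + c, b + a))
    (F : 'M_(b + a, b)) (T T' : 'M_(b + a, a)) (Z : 'M_(a + c, c)) :
  D *m F = 0 -> \det (row_mx F T) != 0 ->
  \det (row_mx (D *m T') Z) * \det (row_mx F T) =
  \det (row_mx (D *m T) Z) * \det (row_mx F T').
Proof.
move=> DF0; rewrite -unitfE -unitmxE; set B := row_mx F T => Bunit.
pose X := usubmx (invmx B *m T'); pose Y := dsubmx (invmx B *m T').
have T'E : T' = F *m X + T *m Y.
  by rewrite -mul_row_col vsubmxK mulKVmx.
have -> : row_mx (D *m T') Z = row_mx (D *m T) Z *m block_mx Y 0 0 1%:M.
  rewrite mul_row_block !mulmx0 mulmx1 addr0 add0r T'E mulmxDr !mulmxA DF0.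
  by rewrite mul0mx add0r.
have -> : row_mx F T' = B *m block_mx 1%:M X 0 Y.
  by rewrite mul_row_block mulmx1 mulmx0 addr0 -T'E.
by rewrite !det_mulmx !det_ublock !det1 mulr1 mul1r mulrAC mulrA.
Qed.

Lemma mulmx_cast (K : pzSemiRingType) a b c e (eq_ab : a = b)
    (X : 'M[K]_(a, c)) (Y : 'M[K]_(e, a)) :
  castmx (erefl, eq_ab) Y *m castmx (eq_ab, erefl) X = Y *m X.
Proof. by case: b / eq_ab; rewrite !castmx_id. Qed.

(** The columns of [E], hence those of [G], span the whole space together with those of [U], and [G]
    and [U] have exactly a + b columns in all. *)
Lemma det_row_mx_complement (K : fieldType) a b c (G : 'M[K]_(a + b, a))
    (U : 'M_(a + b, b)) (E : 'M_(a + b, c)) Z1 Z2 Z3 :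
  1%:M = E *m Z1 + U *m Z2 -> E = G *m Z3 -> \det (row_mx G U) != 0.
Proof.
move=> ZE EG; rewrite -unitfE -unitmxE.
have GU1 : row_mx G U *m col_mx (Z3 *m Z1) Z2 = 1%:M.
  by rewrite mul_row_col mulmxA -EG.
by case: (mulmx1_unit GU1).
Qed.

(** * Cayley determinant of a complex that is exact modulo p in degrees at least 2 *)

Section GenericExactness.
Variables (A : idomainType) (p : prime_idealr A) (s : nat) (m : nat -> nat).
Variable d : forall i, 'M[A]_(m i.+1 + m i, m i.+2 + m i.+1).

Local Notation res := (map_mx (residue p)).

Hypotheses (m0 : m 0%N = 0%N) (ms : m s.+1 = 0%N).
(** [d i] goes from C_(i+1) to C_i. With [d s] set to zero, [exact_d] at i = s - 1 says that the
    last differential is injective modulo p; the condition 0 < i leaves out exactness at C_1. *)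
Hypothesis d_s : d s = 0.
Hypothesis dd : forall i, (i < s)%N -> d i *m d i.+1 = 0.
Hypothesis exact_d : forall i, (0 < i < s)%N ->
  forall z : 'cV[residue_field p]_(m i.+2 + m i.+1), res (d i) *m z = 0 ->
  exists w, z = res (d i.+1) *m w.

(** Descending induction from [d s]: exactness at C_(i+1) and the rank formula give rank (d i) +
    rank (d i.+1) = m i.+2 + m i.+1. It stops before [d 0], whose rank may drop modulo p. The
    transposes turn column spaces into the row spaces of the matrix library. *)
Lemma rank_res_diff l : (l < s)%N -> \rank (res (d (s - l))) = m (s - l).+1.
Proof.
elim: l => [|l IHl] ltls; first by rewrite subn0 d_s map_mx0 mxrank0 ms.
have := IHl (ltnW ltls); have : (s - l = (s - l.+1).+1)%N by rewrite subnSK // ltnW.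
have : (0 < s - l.+1 < s)%N by rewrite subn_gt0 ltls ltn_subrL; case: (s) ltls.
move: (s - l.+1)%N (s - l)%N => i _ i_s -> rk.
have kerE : (kermx (res (d i))^T :=: (res (d i.+1))^T)%MS.
  apply/eqmxP/andP; split.
    apply/row_subP => j; set z := row j _.
    have /exact_d -/(_ i_s)[w] : res (d i) *m z^T = 0.
      apply: trmx_inj; rewrite trmx_mul trmxK trmx0; apply/sub_kermxP.
      exact: row_sub.
    by move/(congr1 trmx); rewrite trmxK trmx_mul => ->; exact: submxMl.
  apply/sub_kermxP; rewrite -trmx_mul -map_mxM dd ?map_mx0 ?trmx0 //.
  by case/andP: i_s.
have := mxrank_ker (res (d i))^T; rewrite kerE !mxrank_tr rk => rkE.
have := rank_leq_col (res (d i)); move: rkE; move: (\rank _) => x.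
by move=> rkE /subnKC; rewrite -rkE addnC => /addnI.
Qed.

(** By the rank computation the image of [d i] modulo p has a complement of dimension [m i]; the
    identity with [Z1] and [Z2] certifies that image and complement span. *)
Lemma res_complement i : (0 < i <= s)%N ->
  exists (U : 'M[A]_(m i.+1 + m i, m i)) Z1 Z2,
    1%:M = res (d i) *m Z1 + res U *m Z2.
Proof.
move=> /andP[i_gt0 lei]; have rk : \rank (res (d i)) = m i.+1.
  by rewrite -(subKn lei) rank_res_diff // ltn_subrL i_gt0 (leq_trans i_gt0).
set E := res (d i) in rk *; pose C := (E^T^C)%MS.
have rkC : \rank C = m i by rewrite mxrank_compl mxrank_tr rk addKn.
have [t [V [tp VE]]] := residue_lift_mx (castmx (rkC, erefl) (row_base C)).
have [[Z1 Z2] Z12] : exists u, 1%:M = u.1 *m E^T + u.2 *m row_base C.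
  apply/sub_addsmxP; rewrite (adds_eqmx (eqmx_refl _) (eq_row_base C)).
  by rewrite submx_full // addsmx_compl_full.
have tr_unit : residue p t \is a GRing.unit by rewrite unitfE residue_neq0.
(* [V] lifts [t] times a basis of the complement, so the coefficients are divided by [t]. *)
exists V^T, Z1^T, ((residue p t)^-1 *: castmx (erefl, rkC) Z2)^T.
apply: trmx_inj; rewrite trmx1 Z12 linearD /= !trmx_mul !trmxK; congr (_ + _).
rewrite map_trmx trmxK VE -scalemxAl -scalemxAr scalerA mulVr // scale1r.
by rewrite mulmx_cast.
Qed.

Let complement_ex i : exists U : 'M[A]_(m i.+1 + m i, m i),
  (0 < i <= s)%N -> exists Z1 Z2, 1%:M = res (d i) *m Z1 + res U *m Z2.
Proof.
case: (boolP (0 < i <= s)%N) => [/res_complement[U ?]|_]; first by exists U.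
by exists 0.
Qed.

Let V i := projT1 (cid (complement_ex i)).

Let VP i (i_s : (0 < i <= s)%N) :
  exists Z1 Z2, 1%:M = res (d i) *m Z1 + res (V i) *m Z2.
Proof. exact: (projT2 (cid (complement_ex i))) i_s. Qed.

(** The columns are the coordinates of the given b_i''; [V i] replaces them by vectors that
    complement the image of [d i] modulo p. *)
Let U i : 'M[A]_(m i.+1 + m i, m i) := col_mx 0 1%:M.

(* With the bases given by U (resp. V) the determinants in the Cayley formula are
   old (resp. new).  As mixed i * mixed i.+1 = old i * new i.+1, the alternating
   product of the old i telescopes to mixed 0, up to factors outside p. *)
Let mixed i := \det (row_mx (d i *m V i.+1) (U i)).
Let new i := \det (row_mx (d i *m V i.+1) (V i)).
Let old i := \det (row_mx (d i *m U i.+1) (U i)).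

Let new_notin i : (0 < i <= s)%N -> new i \notin p.
Proof.
move=> i_s; have [i_gt0 le_is] := andP i_s.
rewrite -residue_neq0 -det_map_mx map_row_mx map_mxM.
have [Z1 [Z2 ZE]] := VP i_s; set G := res (d i) *m res (V i.+1).
(* [V i.+1] complements the image of [d i.+1], which [d i] kills; hence [d i] has the same image on
   [V i.+1] as on the whole of C_(i+1). *)
have [Z3 dE] : exists Z3, res (d i) = G *m Z3.
  have [lt_is|le_si] := ltnP i s; last first.
    exists 0; rewrite mulmx0; have -> : i = s by apply/eqP; rewrite eqn_leq le_is.
    by rewrite d_s map_mx0.
  have [Z4 [Z5 Z45]] := VP (i := i.+1) lt_is.
  exists Z5; rewrite -[LHS]mulmx1 Z45 mulmxDr !mulmxA -map_mxM dd //.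
  by rewrite map_mx0 mul0mx add0r.
exact: det_row_mx_complement ZE dE.
Qed.

Let old_ursub i : old i = \det (ursubmx (d i)).
Proof.
rewrite /old /U -[in LHS](submxK (d i)) mul_block_col !mulmx0 !mulmx1 !add0r.
by rewrite -block_mxEh det_lblock det1 mulr1.
Qed.

Let mixed_s : mixed s = 1.
Proof.
rewrite /mixed /U -[d s *m _]vsubmxK -block_mxEh det_lblock det1 mulr1.
by move: (usubmx _); rewrite ms => X; rewrite det_mx00.
Qed.

Hypothesis old_neq0 : forall i, (i < s)%N -> \det (ursubmx (d i)) != 0.

(** An instance of [det_exchange] over the fraction field: the columns killed by [d i] are
    [d i.+1 *m V i.+2], and [U i.+1] and [V i.+1] are the two completions. *)
Let exchange i : (i < s)%N -> mixed i.+1 != 0 ->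
  mixed i * mixed i.+1 = old i * new i.+1.
Proof.
move=> lt_is mi_neq0; apply/eqP; rewrite -(@tofrac_eq A) !rmorphM /=; apply/eqP.
rewrite /mixed /old /new -!det_map_mx !map_row_mx !map_mxM.
apply: det_exchange; first by rewrite mulmxA -map_mxM dd // map_mx0 mul0mx.
by rewrite -map_mxM -map_row_mx det_map_mx tofrac_eq0.
Qed.

Let prod_old l : (l <= s)%N -> exists x y, [/\ x \notin p, y \notin p,
  mixed (s - l) != 0 &
  tofrac x * \prod_(i < l) tofrac (old (s - l + i)%N) ^ ((-1) ^+ i : int) =
  tofrac (mixed (s - l) * y)].
Proof.
elim: l => [|l IHl] lt_ls.
  by exists 1, 1; rewrite idealr1 subn0 mixed_s oner_neq0 big_ord0 !mulr1 rmorph1.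
have [x [y [xp yp mix_neq0]]] := IHl (ltnW lt_ls).
have -> : (s - l = (s - l.+1).+1)%N by rewrite subnSK.
have lt_j : (s - l.+1 < s)%N by rewrite ltn_subrL; case: (s) lt_ls.
move: mix_neq0; have -> : (s - l = (s - l.+1).+1)%N by rewrite subnSK.
move: (s - l.+1)%N lt_j => j lt_j mix_neq0 prodE.
have newp : new j.+1 \notin p by apply: new_notin.
have exch := exchange lt_j mix_neq0.
have new_neq0 : new j.+1 != 0 by apply: contraNneq newp => ->; exact: idealr0.
(* Prepending [old j] inverts the previous product, equal to mixed j.+1 times y / x; so x and y
   trade places, and [exchange] replaces old j / mixed j.+1 by mixed j / new j.+1. *)
exists (new j.+1 * y), x; split=> //; first exact: primeM.
  have : old j * new j.+1 != 0 by rewrite mulf_neq0 // old_ursub old_neq0.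
  by rewrite -exch mulf_eq0 negb_or => /andP[].
rewrite big_ord_recl /= addn0 expr0 expr1z.
have -> : \prod_(i < l) tofrac (old (j + bump 0 i)) ^ ((-1) ^+ bump 0 i : int) =
   (\prod_(i < l) tofrac (old (j.+1 + i)) ^ ((-1) ^+ i : int))^-1.
  rewrite -prodfV; apply: eq_bigr => i _.
  by rewrite /bump /= add1n addnS addSn exprS mulN1r -invr_expz.
move: prodE; set Q := \prod_(_ < _) _ => prodE.
have Q_neq0 : Q != 0.
  apply: contraTneq (mix_neq0) => Q0; move: prodE; rewrite Q0 mulr0 => /esym/eqP.
  rewrite tofrac_eq0 mulf_eq0 => /orP[->//|/eqP y0].
  by rewrite y0 idealr0 in yp.
apply: (mulIf Q_neq0); rewrite mulrA divfK //.
apply: (mulfI (prime_neq0 xp)); rewrite [in RHS]mulrC -[RHS]mulrA [Q * _]mulrC prodE.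
rewrite -!rmorphM /=; congr tofrac.
have -> : x * (new j.+1 * y * old j) = x * y * (old j * new j.+1) by ring.
rewrite -exch; ring.
Qed.

(** The full telescoping identifies [rho] with [mixed 0] up to factors, of which the one multiplying
    [rho] is outside p. As m 0 = 0, [U 0] has no columns and the matrix of [mixed 0] has rank at
    most that of [d 0] modulo p. *)
Lemma cayley_det_order (k : nat) (rho u : A) :
  (\rank (res (d 0)) + k <= m 1)%N -> u \is a GRing.unit ->
  tofrac rho = tofrac u *
    \prod_(i < s) tofrac (\det (ursubmx (d i))) ^ ((-1) ^+ i : int) ->
  ideal_pow [set x | x \in @loc_max A p]%classic k (to_loc p rho).
Proof.
move=> rk0 u_unit rhoE; have [x [y [xp yp _]]] := prod_old (leqnn s).
rewrite subnn => prodE; apply: (ideal_pow_to_loc xp).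
have -> : x * rho = u * y * mixed 0.
  apply/eqP; rewrite -(@tofrac_eq A) rmorphM /= rhoE mulrCA.
  under eq_bigr do rewrite -old_ursub -[X in old X]add0n.
  by rewrite prodE -rmorphM /= -mulrA [y * _]mulrC.
rewrite rmorphM; apply: ideal_pow_mulr; apply: ideal_pow_det.
rewrite map_row_mx map_mxM -mxrank_tr tr_row_mx.
apply: leq_trans (_ : \rank (res (d 0)) + k <= _)%N; last by rewrite (leq_trans rk0) ?leq_addr.
rewrite leq_add2r -addsmxE (leq_trans (mxrank_adds_leqif _ _)) //.
have -> : \rank (res (U 0))^T = 0%N.
  by apply/eqP; rewrite -leqn0 -[X in (_ <= X)%N]m0 rank_leq_row.
by rewrite addn0 mxrank_tr mxrankM_maxl.
Qed.

End GenericExactness.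

(** * Identities in the Koszul complex *)

Section KoszulAlgebra.
Variables (q : nat) (n : 'I_q -> nat) (B : comNzRingType) (Q : mgmod n B).
Variables (k : nat) (f : 'I_k -> {mpoly B[nvars n]}).

Local Notation koszul_mod := {ffun {set 'I_k} -> coefmod Q}.
Local Notation sgn i J := ((-1) ^+ #|[pred j in J | (j < i)%N]|).
Local Notation diff := (koszul_diff (M := Q) f).

Lemma koszul_sign (R : pzRingType) (i l : 'I_k) (J : {set 'I_k}) : i \notin J ->
  sgn l (i |: J)%SET = (-1) ^+ (i < l)%N * sgn l J :> R.
Proof.
move=> iJ; rewrite -exprD; congr (_ ^+ _).
rewrite (cardD1 i) inE finset.setU11 /=; congr (_ + _)%N.
apply: eq_card => j; rewrite !inE.
by have [->|] := eqVneq j i; rewrite ?(negPf iJ).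
Qed.

Lemma koszul_diffE c J : diff c J =
  \sum_(i | i \notin J) (sgn i J * f i) *: (c (i |: J)%SET : Q) :> Q.
Proof. by rewrite ffunE. Qed.

Fact koszul_diff_is_zmod_morphism : zmod_morphism diff.
Proof.
move=> b c; apply/ffunP => J; rewrite !ffunE -[RHS](@sumrB Q).
by apply: eq_bigr => i _; rewrite !ffunE -scalerBr.
Qed.

HB.instance Definition _ :=
  GRing.isZmodMorphism.Build koszul_mod koszul_mod diff koszul_diff_is_zmod_morphism.

Fact koszul_diff_is_scalable : scalable (koszul_diff (M := Q) f).
Proof.
move=> a c; apply/ffunP => J; rewrite !ffunE.
transitivity (a%:MP *: \sum_(i | i \notin J) (sgn i J * f i) *: (c (i |: J)%SET : Q)) => //.
rewrite scaler_sumr; apply: eq_bigr => i _.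
have -> : (a *: c) (i |: J)%SET = a%:MP *: (c (i |: J)%SET : Q) :> Q by rewrite ffunE.
by rewrite !scalerA mulrC.
Qed.

HB.instance Definition _ := GRing.isScalable.Build B koszul_mod koszul_mod *:%R
  diff koszul_diff_is_scalable.

Lemma koszul_diff2 c : diff (diff c) = 0.
Proof.
apply/ffunP => J; rewrite koszul_diffE ffunE.
pose F (i l : 'I_k) : Q := (sgn i J * f i * (sgn l (i |: J)%SET * f l)) *: (c (l |: (i |: J))%SET : Q).
(* Inserting i and l in the two possible orders gives opposite signs, so the half of the double sum
   with l < i cancels the half with i < l. *)
have FC i l : i \notin J -> l \notin J -> (l < i)%N -> F i l = - F l i.
  move=> iJ lJ lt_li; rewrite /F !koszul_sign // lt_li ltnNge ltnW //= expr0 mul1r expr1.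
  by rewrite finset.setUCA -scaleNr; congr (_ *: _); ring.
transitivity (\sum_(i | i \notin J) \sum_(l | (l \notin J) && (l != i)) F i l).
  apply: eq_bigr => i iJ; rewrite koszul_diffE scaler_sumr.
  apply: eq_big => [l|l _]; last by rewrite scalerA.
  by rewrite !inE negb_or andbC.
transitivity (\sum_(i | i \notin J) \sum_(l | (l \notin J) && (l < i)%N) F i l +
              \sum_(i | i \notin J) \sum_(l | (l \notin J) && (i < l)%N) F i l).
  rewrite -big_split; apply: eq_bigr => i iJ.
  rewrite (bigID (fun l : 'I_k => (l < i)%N)); congr (_ + _); apply: eq_bigl => l.
    by rewrite -andbA; congr andb; rewrite andb_idl // => lt_li; rewrite -val_eqE neq_ltn lt_li.
  rewrite -andbA; congr andb; rewrite -leqNgt [RHS]ltn_neqAle.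
  by rewrite eq_sym -val_eqE.
rewrite [X in _ + X](exchange_big_dep (fun l => l \notin J)) /=; last by move=> i l _ /andP[].
rewrite -big_split big1 // => i iJ; apply/eqP; rewrite addr_eq0 -sumrN; apply/eqP.
apply: eq_big => [l|l /andP[lJ lt_li]]; last by rewrite FC.
by rewrite iJ.
Qed.

(** Left exterior multiplication by the sum of the a_i e_i. *)
Definition koszul_homotopy (a : 'I_k -> {mpoly B[nvars n]}) (c : koszul_mod) :
    koszul_mod :=
  [ffun I : {set 'I_k} => \sum_(i in I) (sgn i I * a i) *: (c (I :\ i)%SET : Q)].

Lemma koszul_homotopyE a c I : koszul_homotopy a c I =
  \sum_(i in I) (sgn i I * a i) *: (c (I :\ i)%SET : Q) :> Q.
Proof. by rewrite ffunE. Qed.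

(** The differential is an antiderivation sending e_i to f_i. In coordinates, inserting and removing
    the same index yields a_i f_i, from the first summand if i is outside J and from the second
    otherwise; the terms [F i l], with i inserted and l removed, cancel. *)
Lemma koszul_homotopyP a c J :
  diff (koszul_homotopy a c) J + koszul_homotopy a (diff c) J =
  (\sum_i a i * f i) *: (c J : Q) :> Q.
Proof.
rewrite koszul_diffE koszul_homotopyE.
pose F (i l : 'I_k) : Q :=
  (sgn i J * f i * (sgn l (i |: J)%SET * a l)) *: (c ((i |: J) :\ l)%SET : Q).
have sgn2 (i : 'I_k) (I : {set 'I_k}) : sgn i I * sgn i I = 1 :> {mpoly B[nvars n]}.
  by rewrite -expr2 sqrr_sign.
rewrite [X in X + _](_ : _ = \sum_(i | i \notin J) (a i * f i) *: (c J : Q) +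
                             \sum_(i | i \notin J) \sum_(l in J) F i l); last first.
  rewrite -big_split; apply: eq_bigr => i iJ.
  rewrite koszul_homotopyE scaler_sumr big_setU1 //=; congr (_ + _); last first.
    by apply: eq_bigr => l _; rewrite scalerA.
  rewrite scalerA finset.setU1K // koszul_sign // ltnn expr0 mul1r; congr (_ *: _).
  by rewrite mulrACA sgn2 mul1r mulrC.
rewrite [X in _ + X](_ : _ = \sum_(l in J) (a l * f l) *: (c J : Q) -
                             \sum_(l in J) \sum_(i | i \notin J) F i l); last first.
  rewrite -sumrN -big_split; apply: eq_bigr => l lJ; have JE := finset.setD1K lJ.
  rewrite koszul_diffE scaler_sumr (bigD1 l) ?finset.setD11 //=; congr (_ + _).
    rewrite scalerA JE; congr (_ *: _).
    rewrite -{1}JE koszul_sign ?finset.setD11 // ltnn expr0 mul1r.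
    by rewrite mulrACA sgn2 mul1r.
  rewrite -sumrN; apply: eq_big => [i|i].
    by rewrite !inE; case: eqVneq => [->|]; rewrite ?lJ ?andbT.
  rewrite !inE => /andP[iJl neq_il].
  have iJ : i \notin J by move: iJl; rewrite neq_il.
  have sJ : sgn i J = (-1) ^+ (l < i)%N * sgn i (J :\ l)%SET :> {mpoly B[nvars n]}.
    by rewrite -[in LHS]JE koszul_sign ?finset.setD11.
  rewrite scalerA /F koszul_sign // sJ.
  rewrite -scaleNr finset.setDUl; have -> : ([set i] :\ l)%SET = [set i]%SET.
    by apply/finset.setDidPl; rewrite finset.disjoints1 inE.
  congr (_ *: _); move: neq_il; rewrite -val_eqE neq_ltn => /orP[] lt_il.
    by rewrite lt_il ltnNge ltnW //= expr1 expr0; ring.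
  by rewrite lt_il ltnNge ltnW //= expr1 expr0; ring.
rewrite exchange_big /= addrACA subrr addr0 scaler_suml.
by rewrite [RHS](bigID (fun i => i \notin J)) /=; congr (_ + _); apply: eq_bigl => i; rewrite negbK.
Qed.

End KoszulAlgebra.

(** * Gradings described by their projections *)

Section Grading.
Variables (q : nat) (n : 'I_q -> nat).

Lemma multideg0 : multideg (0%MM : 'X_{1..nvars n}) = 0%MM.
Proof. by apply/mnmP => i; rewrite !mnmE big1 // => j _; rewrite mnm0E. Qed.

Section Ring.
Variables (A : comNzRingType).

Lemma multihomogC (a : A) : multihomog 0%MM (a%:MP : {mpoly A[nvars n]}).
Proof.
move=> e; rewrite msuppC; case: (a == 0) => //.
by rewrite inE => /eqP ->; exact: multideg0.
Qed.

Lemma multihomogX (e : 'X_{1..nvars n}) :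
  multihomog (multideg e) ('X_[e] : {mpoly A[nvars n]}).
Proof. by move=> e'; rewrite msuppX inE => /eqP ->. Qed.

(* The projections onto the homogeneous components determine the grading: they
   carry over to an extension of scalars without any freeness argument. *)
Definition graded_projection (Q : mgmod n A) (P : 'X_{1..q} -> Q -> Q) : Prop :=
  [/\ forall d x, mg_comp d (P d x),
      forall d, zmod_morphism (P d),
      forall d (x : Q), mg_comp d x -> P d x = x,
      forall e g d (x : Q), multihomog e g -> P (e + d)%MM (g *: x) = g *: P d x
    & forall e g d (x : Q), multihomog e g -> ~~ (e <= d)%MM -> P d (g *: x) = 0].

Section Projection.
Variables (Q : mgmod n A) (P : 'X_{1..q} -> Q -> Q).
Hypothesis PP : graded_projection P.

Lemma gproj_comp d x : mg_comp d (P d x). Proof. by case: PP. Qed.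
Lemma gprojB d : zmod_morphism (P d). Proof. by case: PP. Qed.
Lemma gproj_id d (x : Q) : mg_comp d x -> P d x = x.
Proof. by case: PP => _ _ + _ _; apply. Qed.
Lemma gprojZ e g d (x : Q) : multihomog e g -> P (e + d)%MM (g *: x) = g *: P d x.
Proof. by case: PP => _ _ _ + _; apply. Qed.
Lemma gprojZ0 e g d (x : Q) : multihomog e g -> ~~ (e <= d)%MM -> P d (g *: x) = 0.
Proof. by case: PP => _ _ _ _; apply. Qed.
Lemma gproj0 d : P d 0 = 0.
Proof. by rewrite -[X in P d X](subrr 0) gprojB subrr. Qed.
Lemma gprojN d x : P d (- x) = - P d x.
Proof. by rewrite -sub0r gprojB gproj0 sub0r. Qed.
Lemma gprojD d x y : P d (x + y) = P d x + P d y.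
Proof. by rewrite -{1}[y]opprK gprojB gprojN opprK. Qed.
Lemma gproj_sum d (I : Type) (s : seq I) (R : pred I) (F : I -> Q) :
  P d (\sum_(i <- s | R i) F i) = \sum_(i <- s | R i) P d (F i).
Proof. exact: (big_morph (P d) (gprojD d) (gproj0 d)). Qed.

Lemma gprojC d a x : P d (a%:MP *: x) = a%:MP *: P d x.
Proof. by rewrite -{1}(add0m d) (gprojZ _ _ (@multihomogC a)). Qed.

Lemma gcomp0 d : mg_comp d (0 : Q).
Proof. by rewrite -(gproj0 d); exact: gproj_comp. Qed.
Lemma gcompB d (x y : Q) : mg_comp d x -> mg_comp d y -> mg_comp d (x - y).
Proof.
by move=> /gproj_id <- /gproj_id <-; rewrite -gprojB; exact: gproj_comp.
Qed.
Lemma gcompN d (x : Q) : mg_comp d x -> mg_comp d (- x).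
Proof. by move=> Qx; rewrite -sub0r; apply: gcompB => //; exact: gcomp0. Qed.
Lemma gcompD d (x y : Q) : mg_comp d x -> mg_comp d y -> mg_comp d (x + y).
Proof. by move=> Qx Qy; rewrite -[y]opprK; apply/gcompB/gcompN. Qed.
Lemma gcompZ e g d (x : Q) : multihomog e g -> mg_comp d x ->
  mg_comp (e + d)%MM (g *: x).
Proof. by move=> hg /gproj_id <-; rewrite -(gprojZ _ _ hg); exact: gproj_comp. Qed.
Lemma gcompC d a (x : Q) : mg_comp d x -> mg_comp d (a%:MP *: x).
Proof. by move=> Qx; rewrite -[d]add0m; apply: gcompZ (@multihomogC a) Qx. Qed.
Lemma gcomp_sum d (I : Type) (s : seq I) (R : pred I) (F : I -> Q) :
  (forall i, R i -> mg_comp d (F i)) -> mg_comp d (\sum_(i <- s | R i) F i).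
Proof.
by move=> RF; elim/big_ind: _ => //; [exact: gcomp0 | exact: gcompD].
Qed.

End Projection.

Section Decomposition.
Variables (M : mgmod n A).
Hypothesis M_graded : is_multigraded M.

Let decomposition (x : M) (c : 'X_{1..q} -> M) :=
  (forall d, mg_comp d (c d)) /\
  exists s, [/\ uniq s, forall d, d \notin s -> c d = 0 & x = \sum_(d <- s) c d].

Let comp0 d : mg_comp d (0 : M).
Proof. by case: M_graded => /(_ d)[]. Qed.
Let compB d (x y : M) : mg_comp d x -> mg_comp d y -> mg_comp d (x - y).
Proof. by case: M_graded => /(_ d)[_ +] _ _ _; apply. Qed.

(** A common finite support allows two decompositions to be combined termwise. *)
Let decomposition_sub x y b c : decomposition x b -> decomposition y c ->
  exists s, [/\ uniq s, forall d, d \notin s -> b d = 0 /\ c d = 0,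
                x = \sum_(d <- s) b d & y = \sum_(d <- s) c d].
Proof.
case=> _ [s [us sb ->]] [_ [t [ut tc ->]]]; exists (undup (s ++ t)).
have sumE (r : seq 'X_{1..q}) (F : 'X_{1..q} -> M) : uniq r ->
    {subset r <= s ++ t} -> (forall d, d \notin r -> F d = 0) ->
    \sum_(d <- r) F d = \sum_(d <- undup (s ++ t)) F d.
  move=> ur rst rF; rewrite [RHS](bigID (mem r)) /= [X in _ + X]big1 => [|d /rF //].
  rewrite addr0 -[RHS]big_filter; apply: perm_big; apply: uniq_perm => //.
    exact/filter_uniq/undup_uniq.
  move=> d; rewrite mem_filter mem_undup.
  by case: (boolP (d \in r)) => // /rst ->.
split; first exact: undup_uniq.
- by move=> d; rewrite mem_undup mem_cat negb_or => /andP[/sb -> /tc ->].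
- by apply: sumE => // d ds; rewrite mem_cat ds.
by apply: sumE => // d dt; rewrite mem_cat dt orbT.
Qed.

Let decompositionB x y b c : decomposition x b -> decomposition y c ->
  decomposition (x - y) (fun d => b d - c d).
Proof.
move=> bP cP; have [s [us s0 -> ->]] := decomposition_sub bP cP.
split=> [d|]; first by apply: compB; [case: bP | case: cP].
by exists s; split=> // [d /s0[-> ->]|]; rewrite ?subrr ?sumrB.
Qed.

Let decomposition_uniq x b c : decomposition x b -> decomposition x c -> b =1 c.
Proof.
move=> bP cP; have [s [us s0 _ _]] := decomposition_sub bP cP.
have [_ [t [ut t0 xE]]] := decompositionB bP cP => d.
apply/eqP; rewrite -subr_eq0; apply/eqP.
have [dt|/t0 //] := boolP (d \in t).
case: M_graded => _ _ _ /(_ t (fun d => b d - c d) ut); apply=> //.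
  by move=> e; apply: compB; [case: bP | case: cP].
by rewrite -xE subrr.
Qed.

Let decomposition_ex x : exists c, decomposition x c.
Proof.
case: M_graded => _ _ /(_ x)[s [c [Mc ->]]] _.
elim: s => [|d s [b bP]].
  exists (fun=> 0); split=> //; exists [::]; split=> //; by rewrite !big_nil.
have dP : decomposition (c d) (fun e => if e == d then c e else 0).
  split=> [e|]; first by case: eqP => _.
  exists [:: d]; split=> //; last by rewrite big_seq1 eqxx.
  by move=> e; rewrite inE => /negPf ->.
have zP : decomposition 0 (fun=> 0).
  by split=> //; exists [::]; split=> //; rewrite big_nil.
rewrite big_cons; set y := \sum_(_ <- _) _ in bP *.
have -> : c d + y = c d - (0 - y) by rewrite sub0r opprK.
by eexists; apply: decompositionB dP (decompositionB zP bP).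
Qed.

Let decompositionZ e g x c : multihomog e g -> decomposition x c ->
  decomposition (g *: x)
    (fun d => if (e <= d)%MM then g *: c (d - e)%MM else 0).
Proof.
move=> hg [Mc [s [us s0 xE]]]; split=> [d|].
  case: ifP => // le_ed; rewrite -{1}(submK le_ed) addmC.
  by case: M_graded => _ + _ _; apply.
exists [seq (e + d)%MM | d <- s]; split.
- by rewrite map_inj_uniq // => ? ?; exact: addmI.
- move=> d ds; case: ifP => // le_ed; rewrite s0 ?scaler0 //.
  apply: contra ds => ds; apply/mapP; exists (d - e)%MM => //.
  by rewrite addmC submK.
rewrite big_map xE scaler_sumr; apply: eq_bigr => d _.
by rewrite lem_addr // addmC addmK.
Qed.

(** By uniqueness of decompositions, each axiom reduces to exhibiting one decomposition, of x - y,
    of x or of g *: x. *)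
Lemma graded_projection_exists :
  exists P : 'X_{1..q} -> M -> M, graded_projection P.
Proof.
have /choice[dec decP] := decomposition_ex.
have decE x c : decomposition x c -> dec x =1 c := decomposition_uniq (decP x).
exists (fun d x => dec x d); split.
- by move=> d x; case: (decP x).
- by move=> d x y; rewrite (decE _ _ (decompositionB (decP x) (decP y))).
- move=> d x Mx; rewrite (decE x (fun e => if e == d then x else 0)) ?eqxx //.
  split=> [e|]; first by case: eqP => [->|_].
  exists [:: d]; split=> //; last by rewrite big_seq1 eqxx.
  by move=> e; rewrite inE => /negPf ->.
- move=> e g d x hg; rewrite (decE _ _ (decompositionZ hg (decP x))).
  by rewrite lem_addr // addmC addmK.
- by move=> e g d x hg /negPf led; rewrite (decE _ _ (decompositionZ hg (decP x))) led.
Qed.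

End Decomposition.
End Ring.
End Grading.

(** * Extension of scalars of gradings and of Koszul complexes *)

Section Extension.
Variables (q : nat) (n : 'I_q -> nat) (A B : comNzRingType).
Variables (phi : {rmorphism A -> B}) (M : mgmod n A).

Local Notation T := (tens phi (coefmod M)).

Lemma ptens_scaleC b (t : ptens phi M) : b%:MP *: t = (b *: (t : T) : T).
Proof.
have := ptens_scale_linear t b 1 0; rewrite ptens_scale1 ptens_scale0l !addr0.
by rewrite -mul_mpolyC mulr1.
Qed.

Lemma ptens1_is_zmod_morphism : zmod_morphism (@ptens1 A B phi _ M).
Proof. by move=> x y; exact: (raddfB (tens1 phi (V := coefmod M))). Qed.

HB.instance Definition _ := GRing.isZmodMorphism.Build M (ptens phi M)
  (@ptens1 A B phi _ M) ptens1_is_zmod_morphism.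

Lemma ptens1_map g (x : M) :
  map_mpoly phi g *: (ptens1 phi x : ptens phi M) = ptens1 phi (g *: x).
Proof.
elim/mpolyind: g => [|a e g _ _ IHg]; first by rewrite raddf0 !scale0r raddf0.
rewrite rmorphD /= map_mpolyZ map_mpolyX !scalerDl IHg raddfD /=; congr (_ + _).
rewrite -!mul_mpolyC -!scalerA ptens_scaleC.
have := @ptens_scaleX1 _ _ phi _ M e 1 x; rewrite !scale1r => XE.
by rewrite [X in _ *: X]XE -tens1Z.
Qed.

Section Projection.
Variable P : 'X_{1..q} -> M -> M.
Hypothesis PP : graded_projection P.

Let extP_gen d (x : coefmod M) : T := tens1 phi (P d x : coefmod M).

Definition ext_proj d (t : mg_extend phi M) : mg_extend phi M :=
  tens_lift (extP_gen d) t.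

Let genD d : {morph extP_gen d : u v / u + v}.
Proof. by move=> u v; rewrite /extP_gen (gprojD PP) raddfD. Qed.

Let genZ d a x : extP_gen d (a *: x) = phi a *: extP_gen d x.
Proof.
by rewrite -tens1Z /extP_gen; congr tens1; exact: (gprojC PP).
Qed.

Let ext_projZD d : linear (ext_proj d : T -> T).
Proof. exact: tens_lift_is_linear (@genD d) (@genZ d). Qed.

Let ext_projD d : {morph ext_proj d : x y / x + y}.
Proof. by move=> x y; have := ext_projZD d 1 x y; rewrite !scale1r. Qed.

Let ext_proj0 d : ext_proj d 0 = 0.
Proof. by apply: (addIr (ext_proj d 0)); rewrite -ext_projD !add0r. Qed.

Let ext_projZ d b (x : T) : ext_proj d (b *: x : T) = (b *: (ext_proj d x : T) : T).
Proof.
have := ext_projZD d b x 0; rewrite addr0 => e; rewrite [LHS]e -[RHS]addr0.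
by congr (_ + _); exact: ext_proj0.
Qed.

Let ext_proj_sum d (I : Type) (s : seq I) (R : pred I) (F : I -> T) :
  ext_proj d (\sum_(i <- s | R i) F i) = \sum_(i <- s | R i) (ext_proj d (F i) : T).
Proof. exact: (big_morph _ (@ext_projD d) (ext_proj0 d)). Qed.

Lemma ext_proj1 d x : ext_proj d (ptens1 phi x) = ptens1 phi (P d x).
Proof. exact: (tens_lift1 (@genD d) (@genZ d)). Qed.

(** Polynomials act on the extension monomial by monomial, so the two multiplication axioms reduce
    to monomials of the support of [g]: [L] is a projection when the multidegrees fit, and zero when
    they do not. *)
Let ext_proj_mul (g : {mpoly B[nvars n]}) d (L : M -> M) (b : B) (x : M) :
    (forall c, c \in msupp g -> P d ('X_[c] *: x) = 'X_[c] *: L x) ->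
  ext_proj d (g *: ((b *: tens1 phi (x : coefmod M) : T) : ptens phi M)) =
  g *: ((b *: tens1 phi (L x : coefmod M) : T) : ptens phi M).
Proof.
move=> PL; rewrite [X in ext_proj d X]ptens_scaleZ1 [RHS]ptens_scaleZ1.
rewrite ext_projZ; apply: (congr1 (fun t : T => b *: t)).
rewrite ext_proj_sum /ptens_scale_gen big_seq [RHS]big_seq.
by apply: eq_bigr => c cg; rewrite ext_projZ -PL // ext_proj1.
Qed.

Lemma ext_graded_projection : graded_projection ext_proj.
Proof.
split.
- move=> d t /=; elim/tens_ind: t => [|x y Mx My|b x].
  + by rewrite ext_proj0; exact: rpred0.
  + by rewrite ext_projD; exact: rpredD.
  rewrite ext_projZ; apply: rpredZ; apply: mem_lspan; rewrite [ext_proj _ _]ext_proj1.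
  by exists (P d x) => //; exact: gproj_comp PP _ _.
- move=> d x y; rewrite ext_projD; congr (_ + _).
  by apply/eqP; rewrite -addr_eq0 -ext_projD addNr ext_proj0.
- move=> d t /asboolP[l [c [u [uM ->]]]]; rewrite ext_proj_sum.
  apply: eq_bigr => i _; rewrite ext_projZ; apply: (congr1 (fun t : T => c i *: t)).
  by have [y My ->] := uM i; rewrite ext_proj1 (gproj_id PP My).
- move=> e g d t hg; elim/tens_ind: t => [|x y IHx IHy|b x].
  + by rewrite [X in ext_proj _ X]scaler0 !ext_proj0 scaler0.
  + by rewrite [X in ext_proj _ X]scalerDr !ext_projD IHx IHy -scalerDr.
  rewrite (@ext_proj_mul _ _ (P d)) => [|c cg].
    by rewrite ext_projZ [ext_proj _ _]ext_proj1.
  by rewrite (gprojZ PP) // -(hg c cg); exact: multihomogX.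
move=> e g d t hg led; elim/tens_ind: t => [|x y IHx IHy|b x].
- by rewrite [X in ext_proj _ X]scaler0 !ext_proj0.
- by rewrite [X in ext_proj _ X]scalerDr !ext_projD IHx IHy addr0.
rewrite (@ext_proj_mul _ _ (fun=> 0)) => [|c cg].
  by rewrite raddf0 scaler0 [LHS]scaler0.
rewrite scaler0 (gprojZ0 PP _ _ led) // -(hg c cg); exact: multihomogX.
Qed.

End Projection.

Section KoszulExtension.
Variables (k : nat) (f : 'I_k -> {mpoly A[nvars n]}) (d : 'I_k -> 'X_{1..q}).

Local Notation K := {ffun {set 'I_k} -> coefmod M}.
Local Notation Kext := {ffun {set 'I_k} -> coefmod (mg_extend phi M)}.

Definition koszul_ext (c : K) : Kext :=
  [ffun I : {set 'I_k} => (ptens1 phi (c I : M) : mg_extend phi M)].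

Fact koszul_ext_is_zmod_morphism : zmod_morphism koszul_ext.
Proof.
by move=> b c; apply/ffunP => I; rewrite !ffunE; exact: ptens1_is_zmod_morphism.
Qed.

HB.instance Definition _ :=
  GRing.isZmodMorphism.Build K Kext koszul_ext koszul_ext_is_zmod_morphism.

Lemma koszul_extZ a c : koszul_ext (a *: c) = phi a *: koszul_ext c.
Proof.
apply/ffunP => I; rewrite !ffunE /=; rewrite -[RHS]/((phi a)%:MP *: (ptens1 phi (c I) : ptens phi M)).
by rewrite -map_mpolyC ptens1_map.
Qed.

Lemma koszul_ext_diff c :
  koszul_diff (M := mg_extend phi M) (fun i => map_mpoly phi (f i)) (koszul_ext c) =
  koszul_ext (koszul_diff f c).
Proof.
apply/ffunP => J; rewrite !ffunE raddf_sum; apply: eq_bigr => i _.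
by rewrite -[RHS]ptens1_map ffunE rmorphM /= rmorphXn rmorphN1.
Qed.

End KoszulExtension.

End Extension.

(** * Multigraded components of the Koszul complex, and their bases after extension of scalars *)

Section KoszulComponent.
Variables (q : nat) (n : 'I_q -> nat) (B : comNzRingType) (Q : mgmod n B).
Variables (P : 'X_{1..q} -> Q -> Q) (PP : graded_projection P).
Variables (k : nat) (d : 'I_k -> 'X_{1..q}) (nu : 'X_{1..q}) (m : nat).

Local Notation K := {ffun {set 'I_k} -> coefmod Q}.
Local Notation comp := (koszul_comp (M := Q) d nu m).

Definition koszul_index (I : {set 'I_k}) : bool :=
  (#|I| == m) && ((\sum_(i in I) d i)%MM <= nu)%MM.

Lemma koszul_comp_in c I : comp c -> koszul_index I ->
  mg_comp (nu - \sum_(i in I) d i)%MM (c I : Q).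
Proof. by move=> /(_ I); rewrite /koszul_index /=; case: ifP. Qed.

Lemma koszul_comp_out c I : comp c -> ~~ koszul_index I -> c I = 0.
Proof. by move=> /(_ I); rewrite /koszul_index /=; case: ifP. Qed.

Lemma koszul_comp0 : comp 0.
Proof. by move=> I; rewrite ffunE /=; case: ifP => // _; exact: (gcomp0 PP). Qed.

Lemma koszul_compD b c : comp b -> comp c -> comp (b + c).
Proof.
move=> bP cP I; move: (bP I) (cP I); rewrite ffunE /=; case: ifP => _.
  exact: (gcompD PP).
by move=> -> ->; rewrite addr0.
Qed.

Lemma koszul_compZ (a : B) c : comp c -> comp (a *: c).
Proof.
move=> cP I; move: (cP I); rewrite ffunE /=; case: ifP => _.
  exact: (gcompC PP).
by move=> ->; exact: (@scaler0 _ (coefmod Q)).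
Qed.

Lemma koszul_comp_sum (J : Type) (s : seq J) (R : pred J) (F : J -> K) :
  (forall j, R j -> comp (F j)) -> comp (\sum_(j <- s | R j) F j).
Proof.
by move=> RF; elim/big_ind: _ => //; [exact: koszul_comp0 | exact: koszul_compD].
Qed.

Definition koszul_delta (I : {set 'I_k}) (x : Q) : K :=
  [ffun J : {set 'I_k} => if J == I then x else 0].

Lemma koszul_delta_comp I x : koszul_index I ->
  mg_comp (nu - \sum_(i in I) d i)%MM x -> comp (koszul_delta I x).
Proof.
move=> condI Qx J /=; rewrite -/(koszul_index J) ffunE.
case: (J =P I) => [->|_]; first by rewrite condI.
by case: ifP => // _; exact: (gcomp0 PP).
Qed.

Lemma koszul_deltaD I : {morph koszul_delta I : x y / x + y}.
Proof.
by move=> x y; apply/ffunP=> J; rewrite !ffunE; case: eqP; rewrite ?addr0.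
Qed.

Lemma koszul_deltaZ I a x : koszul_delta I (a%:MP *: x) = a *: koszul_delta I x.
Proof.
apply/ffunP=> J; rewrite !ffunE; case: eqP => // _.
by rewrite (@scaler0 _ (coefmod Q)).
Qed.

Lemma koszul_delta_sum c : comp c ->
  c = \sum_(I | koszul_index I) koszul_delta I (c I).
Proof.
move=> cP; apply/ffunP => J; rewrite sum_ffunE.
have [condJ|condJ] := boolP (koszul_index J).
  rewrite (bigD1 J) //= ffunE eqxx big1 ?addr0 // => I /andP[_ neq_IJ].
  by rewrite ffunE eq_sym (negPf neq_IJ).
rewrite big1 => [|I condI].
  exact: koszul_comp_out.
by rewrite ffunE; case: eqP => // JI; rewrite JI condI in condJ.
Qed.

End KoszulComponent.

Section KoszulBasis.
Variables (q : nat) (n : 'I_q -> nat) (A B : comNzRingType).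
Variables (phi : {rmorphism A -> B}) (M : mgmod n A).
Variables (P : 'X_{1..q} -> M -> M) (PP : graded_projection P).
Variables (k : nat) (d : 'I_k -> 'X_{1..q}) (nu : 'X_{1..q}) (m : nat).
Variables (N : nat) (b : 'I_N -> {ffun {set 'I_k} -> coefmod M}).

Local Notation comp := (koszul_comp (M := M) d nu m).
Local Notation comp_ext := (koszul_comp (M := mg_extend phi M) d nu m).
Local Notation delta Q := (@koszul_delta _ _ _ Q k).
Local Notation ext := (koszul_ext phi (M := M) (k := k)).
Local Notation ind := (koszul_index d nu m).
Local Notation degsum I := (\sum_(i in I) d i)%MM.
Local Notation PX := (ext_graded_projection phi PP).

Hypothesis b_basis : is_basis comp b.

Lemma koszul_ext_comp c : comp c -> comp_ext (ext c).
Proof.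
move=> cP I; move: (cP I); rewrite ffunE /=; case: ifP => _ => [Mc|->].
  by apply: mem_lspan; exists (c I).
exact: raddf0.
Qed.

Lemma koszul_ext_delta I x : ext (delta M I x) = delta (mg_extend phi M) I (ptens1 phi x).
Proof. by apply/ffunP => J; rewrite !ffunE; case: eqP => // _; exact: raddf0. Qed.

(** The chains supported at one subset with value y (x) 1 generate, and they come from chains over
    M, where [b] spans. *)
Lemma koszul_ext_span x : comp_ext x ->
  exists c : 'rV[B]_N, x = \sum_l c 0 l *: ext (b l).
Proof.
pose spanned y := exists c : 'rV[B]_N, y = \sum_l c 0 l *: ext (b l).
have sp0 : spanned 0.
  by exists 0; rewrite big1 // => l _; rewrite mxE scale0r.
have spD y z : spanned y -> spanned z -> spanned (y + z).
  move=> [c ->] [c' ->]; exists (c + c'); rewrite -big_split.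
  by apply: eq_bigr => l _; rewrite mxE scalerDl.
have spZ a y : spanned y -> spanned (a *: y).
  move=> [c ->]; exists (a *: c); rewrite scaler_sumr.
  by apply: eq_bigr => l _; rewrite mxE scalerA.
move=> xP; rewrite (koszul_delta_sum xP); elim/big_ind: _ => // I condI.
have /asboolP[l [c [u [uM ->]]]] := koszul_comp_in xP condI.
rewrite (big_morph _ (@koszul_deltaD _ _ _ _ _ I) (_ : _ = 0)); last first.
  by apply/ffunP => J; rewrite !ffunE if_same.
elim/big_ind: _ => // i _; have [y My ->] := uM i.
have -> : delta (mg_extend phi M) I (c i *: (ptens1 phi y : tens phi (coefmod M))) =
   c i *: delta (mg_extend phi M) I (ptens1 phi y).
  by rewrite -koszul_deltaZ; congr koszul_delta; rewrite [RHS]ptens_scaleC.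
apply: (spZ); rewrite -koszul_ext_delta.
have [_ /(_ (delta M I y))[|a [-> _]]] := b_basis.
  exact: (koszul_delta_comp PP).
rewrite raddf_sum; elim/big_ind: _ => // j _; rewrite /= koszul_extZ.
apply: spZ; exists (delta_mx 0 j).
rewrite (bigD1 j) //= mxE !eqxx scale1r big1 ?addr0 // => j' /negPf neq_j.
by rewrite mxE neq_j andbF scale0r.
Qed.

(* The coordinate functions of the basis b, precomposed with the projections
   onto the components, are defined on all of M, hence extend to M (x) B. *)
Lemma koszul_ext_free (c : 'rV[B]_N) :
  \sum_l c 0 l *: ext (b l) = 0 -> c = 0.
Proof.
have [bcomp bP] := b_basis.
have /choice[lam lamP] : forall v, exists a : 'rV[A]_N, comp v ->
    v = \sum_l a 0 l *: b l /\ forall a' : 'rV[A]_N, v = \sum_l a' 0 l *: b l -> a = a'.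
  move=> v; case: (pselect (comp v)) => [/bP[a [? ?]]|?]; first by exists a.
  by exists 0.
have lamE v (a : 'rV[A]_N) : comp v -> v = \sum_l a 0 l *: b l -> lam v = a.
  by move=> /lamP[_]; apply.
have lamD u v : comp u -> comp v -> lam (u + v) = lam u + lam v.
  move=> uP vP; apply: lamE; first exact: (koszul_compD PP).
  rewrite {1}(lamP u uP).1 {1}(lamP v vP).1 -big_split; apply: eq_bigr => l _.
  by rewrite mxE scalerDl.
have lamZ a v : comp v -> lam (a *: v) = a *: lam v.
  move=> vP; apply: lamE; first exact: (koszul_compZ PP).
  rewrite {1}(lamP v vP).1 scaler_sumr; apply: eq_bigr => l _.
  by rewrite mxE scalerA.
have lam_b j l : lam (b j) 0 l = (j == l)%:R.
  rewrite (lamE _ (delta_mx 0 j)) // ?mxE 1?eq_sym //.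
  rewrite (bigD1 j) //= mxE !eqxx scale1r big1 ?addr0 // => j' /negPf neq_j.
  by rewrite mxE neq_j andbF scale0r.
pose g l (I : {set 'I_k}) (y : coefmod M) : B^o :=
  phi (if ind I then lam (delta M I (P (nu - degsum I)%MM y)) 0 l else 0).
have dcomp I y : ind I -> comp (delta M I (P (nu - degsum I)%MM y)).
  by move=> condI; apply: (koszul_delta_comp PP) => //; exact: (gproj_comp PP).
have gD l I : {morph g l I : u v / u + v}.
  move=> u v; rewrite /g -rmorphD; congr (phi _).
  case: ifP => [condI|_]; last by rewrite addr0.
  by rewrite (gprojD PP) koszul_deltaD lamD ?mxE //; exact: dcomp.
have gZ l I a u : g l I (a *: u) = phi a *: g l I u.
  rewrite /g -[RHS]/(phi a * phi _) -rmorphM; congr (phi _).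
  case: ifP => [condI|_]; last by rewrite mulr0.
  have -> : P (nu - degsum I)%MM (a *: u) = a%:MP *: P (nu - degsum I)%MM u.
    exact: (gprojC PP).
  by rewrite koszul_deltaZ lamZ ?mxE //; exact: dcomp.
pose G l (x : {ffun {set 'I_k} -> coefmod (mg_extend phi M)}) : B^o :=
  \sum_I tens_lift (g l I) (x I).
have GL l a (x y : {ffun {set 'I_k} -> coefmod (mg_extend phi M)}) :
    G l (a *: x + y) = a * G l x + G l y.
  rewrite /G mulr_sumr -big_split; apply: eq_bigr => I _; rewrite !ffunE.
  rewrite -[RHS](tens_lift_is_linear (@gD l I) (@gZ l I)); congr tens_lift.
  congr (_ + _); exact: ptens_scaleC.
have G0 l : G l 0 = 0.
  by have := GL l (-1) 0 0; rewrite scaler0 addr0 mulN1r addNr.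
have Gext l v : comp v -> G l (ext v) = phi (lam v 0 l).
  move=> vP; transitivity (\sum_I g l I (v I)).
    by apply: eq_bigr => I _; rewrite ffunE; exact: (tens_lift1 (@gD l I) (@gZ l I)).
  rewrite /g -rmorph_sum; congr (phi _); rewrite -big_mkcond.
  have -> : lam v = \sum_(I | ind I) lam (delta M I (v I)).
    have {1}-> := koszul_delta_sum vP.
    pose R (u : {ffun {set 'I_k} -> coefmod M}) a := comp u /\ lam u = a.
    suff [] : R (\sum_(I | ind I) delta M I (v I)) (\sum_(I | ind I) lam (delta M I (v I))) by [].
    elim/big_ind2: _ => [|u1 a1 u2 a2 [? <-] [? <-]|I condI]; split=> //.
    - exact: (koszul_comp0 PP).
    - apply: lamE; first exact: (koszul_comp0 PP).
      by rewrite big1 // => j _; rewrite mxE scale0r.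
    - exact: (koszul_compD PP).
    - exact: lamD.
    apply: (koszul_delta_comp PP) => //.
    exact: koszul_comp_in vP condI.
  rewrite summxE; apply: eq_bigr => I condI; rewrite (gproj_id PP) //.
  exact: koszul_comp_in vP condI.
move=> c0; apply/rowP => l; rewrite mxE.
have : G l (\sum_j c 0 j *: ext (b j)) = c 0 l.
  transitivity (\sum_j c 0 j * (j == l)%:R).
    elim/big_ind2: _ => [|_ x _ y <- <-|j _]; first exact: G0.
      by have := GL l 1 x y; rewrite scale1r mul1r.
    by rewrite -[X in G _ X]addr0 GL G0 addr0 Gext // lam_b rmorph_nat.
  rewrite (bigD1 l) //= eqxx mulr1 big1 ?addr0 // => j /negPf ->.
  by rewrite mulr0.
by rewrite c0 G0.
Qed.

End KoszulBasis.

(** * Filter-regular sequences kill Koszul homology in large multidegrees *)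

Section Depth.
Variables (q : nat) (n : 'I_q -> nat) (B : comNzRingType) (Q : mgmod n B).
Variables (P : 'X_{1..q} -> Q -> Q) (PP : graded_projection P).

(** This is the generating set used by [mg_quot]. Working in Q modulo its span keeps all Koszul
    chains in one module while [t] varies. *)
Definition multiples (t : seq {mpoly B[nvars n]}) : set Q :=
  [set x : Q | exists2 g, g \in t & exists y : Q, x = g *: y]%classic.

Local Notation sub t := (lspan (multiples t)).

Lemma multiples_rcons t g x : x \in sub (rcons t g) ->
  exists y, x - g *: y \in sub t.
Proof.
move=> /asboolP[k [c [u [uS ->]]]]; elim/big_ind: _ => [|a b [y ay] [z bz]|i _].
- by exists 0; rewrite scaler0 subr0 rpred0.
- by exists (y + z); rewrite scalerDr opprD addrACA rpredD.
have [h + [y ->]] := uS i; rewrite mem_rcons inE => /predU1P[->|ht].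
  by exists (c i *: y); rewrite !scalerA mulrC subrr rpred0.
by exists 0; rewrite scaler0 subr0 rpredZ // mem_lspan //; exists h => //; exists y.
Qed.

Lemma multiples_sub t t' x : {subset t <= t'} -> x \in sub t -> x \in sub t'.
Proof.
move=> tt' /asboolP[k [c [u [uS ->]]]]; apply: rpred_sum => i _; apply: rpredZ.
by apply: mem_lspan; have [h /tt' ht' [y ->]] := uS i; exists h => //; exists y.
Qed.

Lemma multiples_proj t d x : (forall g, g \in t -> exists e, multihomog e g) ->
  x \in sub t -> P d x \in sub t.
Proof.
move=> t_homog /asboolP[k [c [u [uS ->]]]]; rewrite (gproj_sum PP).
apply: rpred_sum => i _; have [h ht [y ->]] := uS i; have [e hh] := t_homog h ht.
rewrite scalerA mulrC -scalerA.
have [le_ed|nle_ed] := boolP (e <= d)%MM; last first.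
  by rewrite (gprojZ0 PP _ hh) // rpred0.
rewrite -(submK le_ed) addmC (gprojZ PP _ _ hh).
by apply: mem_lspan; exists h => //; eexists.
Qed.

Lemma filter_regular_quot g t : filter_regular g (mg_quot Q t) ->
  eventually (fun d => forall x : Q, mg_comp d x -> g *: x \in sub t -> x \in sub t).
Proof.
move=> [d0 reg]; exists d0 => d le_d x Qx gx; rewrite -[x]subr0.
apply/(lquot_piP (multiples t)); rewrite raddf0; apply: (reg d le_d); first by exists x.
by rewrite -linearZ -[RHS](raddf0 (lquot_pi (multiples t))); apply/lquot_piP; rewrite subr0.
Qed.

Variables (k : nat) (f : 'I_k -> {mpoly B[nvars n]}) (d : 'I_k -> 'X_{1..q}).
Hypothesis f_homog : forall i, multihomog (d i) (f i).

Local Notation K := {ffun {set 'I_k} -> coefmod Q}.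
Local Notation comp nu m := (koszul_comp (M := Q) d nu m).
Local Notation diff := (koszul_diff (M := Q) f).
Local Notation degsum I := (\sum_(i in I) d i)%MM.
Local Notation ind nu m := (koszul_index d nu m).

Let sgn_homog i (J : {set 'I_k}) :
  multihomog (d i) ((-1) ^+ #|[pred j in J | (j < i)%N]| * f i).
Proof.
move=> e; rewrite -signr_odd; case: odd; rewrite ?mul1r; last exact: f_homog.
by rewrite expr1 mulN1r (perm_mem (msuppN _)); exact: f_homog.
Qed.

Let degsumU i (J : {set 'I_k}) : i \notin J ->
  degsum (i |: J)%SET = (d i + degsum J)%MM.
Proof. by move=> iJ; rewrite big_setU1. Qed.

Let degsum_le (J : {set 'I_k}) : (degsum J <= \sum_i d i)%MM.
Proof. by rewrite [X in (_ <= X)%MM](bigID (mem J)) /= lem_addr. Qed.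

Lemma koszul_diff_comp nu m b : comp nu m.+1 b -> comp nu m (diff b).
Proof.
move=> bP J /=; rewrite -/(koszul_index d nu m J).
have cardU i : i \notin J -> #|(i |: J)%SET| = #|J|.+1 by rewrite cardsU1 => ->.
case: ifP => [/andP[/eqP cardJ le_J]|indJ].
  rewrite koszul_diffE; apply: (gcomp_sum PP) => i iJ.
  have [indU|indU] := boolP (ind nu m.+1 (i |: J)%SET); last first.
    rewrite (koszul_comp_out bP indU) (@scaler0 _ Q); exact: (gcomp0 PP).
  have -> : (nu - degsum J = d i + (nu - degsum (i |: J)%SET))%MM.
    move: indU => /andP[_ /mnm_lepP]; rewrite degsumU // => le_U.
    by apply/mnmP => j; move: (le_U j); rewrite !(mnmDE, mnmBE); lia.
  exact: (gcompZ PP (@sgn_homog i J) (koszul_comp_in bP indU)).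
rewrite koszul_diffE big1 // => i iJ; rewrite (koszul_comp_out bP) ?scaler0 //.
apply: contraFN indJ => /andP[cardJ le_U]; rewrite /koszul_index.
move: cardJ; rewrite cardU // eqSS => -> /=; apply: lepm_trans le_U.
by rewrite degsumU // lem_addl.
Qed.

(** Cuts a chain down to multidegree [nu]; the homotopy along non-homogeneous a_i mixes
    multidegrees. *)
Definition koszul_proj nu (c : K) : K :=
  [ffun J : {set 'I_k} => P (nu - degsum J)%MM (c J)].

(** The bound on [nu] ensures that no subtraction [nu - degsum J] is truncated. *)
Lemma koszul_proj_diff nu c : (\sum_i d i <= nu)%MM ->
  diff (koszul_proj nu c) = koszul_proj nu (diff c).
Proof.
move=> le_nu; apply/ffunP => J; rewrite [RHS]ffunE koszul_diffE koszul_diffE.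
rewrite (gproj_sum PP); apply: eq_bigr => i iJ; rewrite ffunE.
have -> : (nu - degsum J = d i + (nu - degsum (i |: J)%SET))%MM.
  move: (lepm_trans (degsum_le (i |: J)%SET) le_nu) => /mnm_lepP.
  rewrite degsumU // => le_U.
  by apply/mnmP => j; move: (le_U j); rewrite !(mnmDE, mnmBE); lia.
by rewrite (gprojZ PP _ _ (@sgn_homog i J)).
Qed.

(** Vanishing of the m-th homology of the Koszul complex on Q/(t)Q in large multidegrees, phrased
    with representatives in Q. *)
Definition koszul_exact (t : seq {mpoly B[nvars n]}) (m : nat) : Prop :=
  eventually (fun nu => forall c, comp nu m c -> (forall J, (diff c J : Q) \in sub t) ->
    exists2 b, comp nu m.+1 b & forall J, (c J - diff b J : Q) \in sub t).

(* For a cycle c modulo (t), the contraction h along the a_i satisfies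
   diff (h c) = g c modulo (t), so exactness modulo (t, g) in degree m + 1 gives
   u with h c - g u a boundary modulo (t).  Applying diff, g (c - diff u) = 0
   modulo (t), and g is cancelled by filter-regularity. *)
Lemma koszul_exact_step t g e m :
  (forall h, h \in t -> exists e, multihomog e h) ->
  multihomog e g -> (exists a, g = \sum_i a i * f i) ->
  filter_regular g (mg_quot Q t) ->
  koszul_exact (rcons t g) m.+1 -> koszul_exact t m.
Proof.
move=> t_homog g_homog [a gE] /filter_regular_quot[d1 reg] [d0 exact].
(* [d0] serves exactness modulo (t, g) in multidegree e + nu, and [d1] serves the cancellation of g
   in the multidegrees nu - degsum J; the last sum keeps the subtractions exact. *)
exists (d0 + d1 + \sum_i d i)%MM => nu le_nu c cP dc.
have le_D : (\sum_i d i <= nu)%MM by apply: lepm_trans le_nu; exact: lem_addl.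
have shiftE (J : {set 'I_k}) : (e + nu - degsum J = e + (nu - degsum J))%MM.
  have /mnm_lepP le_J := lepm_trans (degsum_le J) le_D.
  by apply/mnmP => j; move: (le_J j); rewrite !(mnmDE, mnmBE); lia.
have sub_rcons x : x \in sub t -> x \in sub (rcons t g).
  by apply: multiples_sub => h ht; rewrite mem_rcons inE ht orbT.
pose w := koszul_proj (e + nu)%MM (koszul_homotopy a c).
have wP : comp (e + nu)%MM m.+1 w.
  move=> J /=; rewrite ffunE -/(koszul_index d (e + nu)%MM m.+1 J).
  case: ifP => [_|indJ]; first exact: (gproj_comp PP).
  rewrite [X in P _ X](_ : _ = 0) ?(gproj0 PP) // koszul_homotopyE.
  apply: big1 => i iJ.
  rewrite (koszul_comp_out cP) ?scaler0 //; apply: contraFN indJ.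
  rewrite /koszul_index (cardsD1 i J) iJ add1n eqSS => /andP[-> _].
  by apply: lepm_trans (degsum_le J) (lepm_trans le_D (lem_addl _ _)).
have dw J : (diff w J - g *: (c J : Q) : Q) \in sub t.
  have le_D' : (\sum_i d i <= e + nu)%MM := lepm_trans le_D (lem_addl _ _).
  have := koszul_homotopyP f a c J; rewrite -gE => /(canRL (addrK _)) homE.
  rewrite koszul_proj_diff // ffunE homE (gprojB PP) shiftE (gprojZ PP _ _ g_homog).
  have -> : P (nu - degsum J)%MM (c J) = c J.
    have [indJ|indJ] := boolP (ind nu m J).
      exact: (gproj_id PP) (koszul_comp_in cP indJ).
    by rewrite (koszul_comp_out cP indJ) (gproj0 PP).
  rewrite addrAC subrr sub0r rpredN; apply: multiples_proj => //.
  by rewrite koszul_homotopyE; apply: rpred_sum => i _; apply: rpredZ.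
have [||b bP wb] := exact (e + nu)%MM _ w wP.
- apply: lepm_trans (lem_addl e nu); apply: lepm_trans le_nu.
  by rewrite -addmA lem_addr.
- move=> J; rewrite -[X in X \in _](subrK (g *: (c J : Q))).
  apply: rpredD; first exact/sub_rcons/dw.
  by apply: mem_lspan; exists g; [rewrite mem_rcons inE eqxx | exists (c J)].
pose z := w - diff b.
have zE J : z J = w J - diff b J :> Q.
  by have subE (x y : K) : (x - y) J = x J - y J by [rewrite !ffunE]; exact: subE.
(* Modulo (t), z J is a multiple of g. Since z J is homogeneous and (t)Q is graded, the cofactor can
   be projected, so that [u] becomes a chain of multidegree nu. *)
have /choice[u0 u0P] : forall J : {set 'I_k}, exists u : Q,
    (if ind nu m.+1 J then mg_comp (nu - degsum J)%MM u else u = 0) /\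
    (z J : Q) - g *: u \in sub t.
  move=> J; have dbP := koszul_diff_comp bP.
  have [indJ|indJ] := boolP (ind (e + nu)%MM m.+1 J); last first.
    have /negPf-> : ~~ ind nu m.+1 J.
      apply: contra indJ => /andP[cardJ le_J]; rewrite /koszul_index cardJ.
      exact: lepm_trans le_J (lem_addl _ _).
    exists 0; split=> //; rewrite zE (koszul_comp_out wP indJ).
    by rewrite (koszul_comp_out dbP indJ) subr0 scaler0 subr0 rpred0.
  have [y zy] := multiples_rcons (wb J); exists (P (nu - degsum J)%MM y); split.
    case: ifP => [_|]; first exact: (gproj_comp PP).
    move: indJ => /andP[cardJ _]; rewrite /koszul_index cardJ.
    by rewrite (lepm_trans (degsum_le J) le_D).
  have zP : mg_comp (e + nu - degsum J)%MM (z J : Q).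
    rewrite zE; apply: (gcompB PP); first exact: koszul_comp_in wP indJ.
    exact: koszul_comp_in dbP indJ.
  rewrite -(gproj_id PP zP) shiftE -(gprojZ PP _ _ g_homog) -(gprojB PP).
  by apply: multiples_proj => //; rewrite zE.
pose u : K := [ffun J : {set 'I_k} => u0 J].
have uP : comp nu m.+1 u by move=> J; rewrite ffunE; exact: (u0P J).1.
exists u => // J; have duP := koszul_diff_comp uP.
have [indJ|indJ] := boolP (ind nu m J); last first.
  by rewrite (koszul_comp_out cP indJ) (koszul_comp_out duP indJ) subr0 rpred0.
apply: (reg (nu - degsum J)%MM).
- have le_J := mnm_lepP (degsum_le J); have /mnm_lepP {}le_nu := le_nu.
  apply/mnm_lepP => j; move: (le_J j) (le_nu j); rewrite !(mnmDE, mnmBE); lia.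
- by apply: (gcompB PP); [exact: koszul_comp_in cP _ | exact: koszul_comp_in duP _].
have dzu : (diff w J : Q) - g *: (diff u J : Q) \in sub t.
  have -> : diff w = diff z by rewrite raddfB /= koszul_diff2 subr0.
  rewrite !koszul_diffE scaler_sumr -sumrB; apply: rpred_sum => i iJ.
  rewrite scalerA [g * _]mulrC -[X in _ - X]scalerA -scalerBr; apply: rpredZ.
  by rewrite [u _]ffunE; exact: (u0P _).2.
rewrite scalerBr -(subrKA (diff w J : Q)) rpredD //.
by rewrite -opprB rpredN; exact: dw.
Qed.

(** Modulo all of [s] exactness is trivial above degree k, where there are no chains. Each element
    dropped from the end of [s] then gains one homological degree by [koszul_exact_step]. *)
Lemma koszul_exact_depth (s : seq {mpoly B[nvars n]}) m :
  filter_regular_seq s Q ->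
  (forall g, g \in s -> exists a, g = \sum_i a i * f i) ->
  (k < m + size s)%N -> koszul_exact [::] m.
Proof.
move=> s_reg s_ideal lt_km.
suff : forall j, (j <= size s)%N -> forall i, (k < i + j)%N ->
    koszul_exact (take (size s - j) s) i.
  by move=> /(_ _ (leqnn _) _ lt_km); rewrite subnn take0.
elim=> [|j IHj] lt_js i lt_ki.
  exists 0%MM => nu _ c cP _; exists 0; first exact: (koszul_comp0 PP).
  move=> J; rewrite raddf0 ffunE subr0 (koszul_comp_out cP) ?rpred0 //.
  apply/negP => /andP[/eqP cardJ _].
  by move: (max_card (mem J)); rewrite card_ord cardJ leqNgt -[i]addn0 lt_ki.
have lt_s : (size s - j.+1 < size s)%N by rewrite ltn_subrL; case: (size s) lt_js.
have [[e g_homog] g_reg] := s_reg _ lt_s.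
apply: (koszul_exact_step _ g_homog _ g_reg).
- by move=> h /mem_take /(nthP 0)[l lt_ls <-]; exact: (s_reg l lt_ls).1.
- exact/s_ideal/mem_nth.
by rewrite -take_nth // subnSK //; apply: IHj; [exact: ltnW | rewrite addSnnS].
Qed.

End Depth.

(** If no integer qualifies as the order, [ord_at] is [None], which is above every [k]; otherwise
    the powers are decreasing. *)
Lemma le_ord_at (A : idomainType) (p : prime_idealr A) k a :
  ideal_pow [set x | x \in @loc_max A p]%classic k a -> le_enat k (ord_at a).
Proof.
move=> ak; rewrite /ord_at; case: xgetP => //= e _ [l -> [_ a_notin]] /=.
by rewrite leqNgt; apply/negP => lt_lk; apply/a_notin/(ideal_pow_le lt_lk).
Qed.

Lemma is_basis_free (A : comNzRingType) (V : lmodType A) (S : set V) k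
    (b : 'I_k -> V) (c : 'rV[A]_k) :
  is_basis S b -> S 0 -> \sum_l c 0 l *: b l = 0 -> c = 0.
Proof.
move=> [_ bP] /bP[c' [_ c'U]] c0; rewrite -(c'U c) ?c0 //.
by apply: c'U; rewrite big1 // => l _; rewrite mxE scale0r.
Qed.

Lemma leq_basis_span (F : fieldType) (V : lmodType F) (S : set V) k l
    (v : 'I_k -> V) (w : 'I_l -> V) :
  is_basis S v -> (forall t, S (w t)) ->
  (forall x, S x -> exists c : 'rV[F]_l, x = \sum_t c 0 t *: w t) -> (k <= l)%N.
Proof.
move=> [Sv vP] Sw span.
have /choice[C CP] : forall i, exists c : 'rV[F]_l, v i = \sum_t c 0 t *: w t.
  by move=> i; exact: span.
have /choice[E EP] : forall t, exists c : 'rV[F]_k, w t = \sum_j c 0 j *: v j.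
  by move=> t; have [c [-> _]] := vP _ (Sw t); exists c.
pose CM := \matrix_(i, t) C i 0 t; pose EM := \matrix_(t, j) E t 0 j.
suff CE1 : CM *m EM = 1%:M.
  by rewrite -(@mxrank1 F k) -CE1 (leq_trans (mxrankM_maxl _ _)) ?rank_leq_col.
apply/row_matrixP => i; have [c [_ cU]] := vP _ (Sv i).
rewrite -(cU (row i 1%:M)); last first.
  rewrite (bigD1 i) //= !mxE eqxx scale1r big1 ?addr0 // => j neq_ji.
  by rewrite !mxE eq_sym (negPf neq_ji) scale0r.
apply/esym/cU; rewrite {1}(CP i).
transitivity (\sum_t \sum_j (C i 0 t * E t 0 j) *: v j).
  apply: eq_bigr => t _; rewrite {1}EP scaler_sumr.
  by apply: eq_bigr => j _; rewrite scalerA.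
rewrite exchange_big; apply: eq_bigr => j _; rewrite -scaler_suml; congr (_ *: _).
by rewrite !mxE; apply: eq_bigr => t _; rewrite !mxE.
Qed.

(** * Large multidegrees, and the relevant degree as a dimension *)

Section Eventually.
Variable q : nat.

Lemma eventually_and (P R : 'X_{1..q} -> Prop) :
  eventually P -> eventually R -> eventually (fun d => P d /\ R d).
Proof.
move=> [d0 dP] [d1 dR]; exists (d0 + d1)%MM => d le_d; split.
  exact/dP/(lepm_trans (lem_addr d0 d1)).
exact/dR/(lepm_trans (lem_addl d0 d1)).
Qed.

Lemma eventually_forall (N : nat) (P : nat -> 'X_{1..q} -> Prop) :
  (forall i, (i < N)%N -> eventually (P i)) ->
  eventually (fun d => forall i, (i < N)%N -> P i d).
Proof.
elim: N => [|N IHN] NP; first by exists 0%MM.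
have [d0 d0P] := eventually_and (IHN (fun i lt_i => NP i (ltnW lt_i))) (NP N (leqnn _)).
exists d0 => d /d0P[dP dPN] i; rewrite ltnS leq_eqVlt => /predU1P[->//|].
exact: dP.
Qed.

Lemma eventually_ex (P : 'X_{1..q} -> Prop) : eventually P -> exists d, P d.
Proof. by move=> [d dP]; exists d; apply: dP; exact: lepm_refl. Qed.

End Eventually.

Section Multigraded.
Variables (q : nat) (n : 'I_q -> nat).

(** Positivity excludes the default value 0 of both [xget]s, so there is a Hilbert polynomial and it
    is the constant [rdeg M]. *)
Lemma rdeg_basis (A : idomainType) (M : mgmod n A) : (0 < rdeg M)%N ->
  eventually (fun d => exists b : 'I_(rdeg M) -> coefmod (mg_extend (@tofrac A) M),
    is_basis (mg_comp d : set (coefmod (mg_extend (@tofrac A) M))) b).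
Proof.
rewrite /rdeg; case: xgetP => // k _ HE k_gt0; move: HE; rewrite /= /hilbert_poly.
case: xgetP => [H _ [d0 HP] HE|_ /esym/eqP]; last first.
  by rewrite -mpolyC_nat mpolyC_eq0 pnatr_eq0 => /eqP k0; rewrite k0 in k_gt0.
exists d0 => d /HP[k' [b [bP]]]; rewrite HE rmorph_nat => /eqP.
by rewrite eqr_nat => /eqP kE; move: b bP; rewrite -kE => b; exists b.
Qed.

Lemma multihomog_map (A B : comNzRingType) (phi : {rmorphism A -> B}) d
    (g : {mpoly A[nvars n]}) :
  multihomog d g -> multihomog d (map_mpoly phi g).
Proof.
move=> g_homog e; rewrite mcoeff_msupp mcoeff_map_mpoly => phi_neq0.
apply: g_homog; rewrite mcoeff_msupp; apply: contraNneq phi_neq0 => ->.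
by rewrite raddf0.
Qed.

End Multigraded.

Lemma koszul_ext_diff_comb (q : nat) (n : 'I_q -> nat) (A B : comNzRingType)
    (phi : {rmorphism A -> B}) (M : mgmod n A) k (f : 'I_k -> {mpoly A[nvars n]})
    N N' (b : 'I_N -> {ffun {set 'I_k} -> coefmod M}) (b' : 'I_N' -> _)
    (E : 'M[A]_(N, N')) :
  (forall j, koszul_diff f (b' j) = \sum_l E l j *: b l) ->
  forall z : 'cV[B]_N',
  koszul_diff (M := mg_extend phi M) (fun i => map_mpoly phi (f i))
    (\sum_j z j 0 *: koszul_ext phi (b' j)) =
  \sum_l (map_mx phi E *m z) l 0 *: koszul_ext phi (b l).
Proof.
move=> bE z; rewrite raddf_sum /=.
transitivity (\sum_j \sum_l (phi (E l j) * z j 0) *: koszul_ext phi (b l)).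
  apply: eq_bigr => j _; rewrite linearZ_LR /= koszul_ext_diff bE raddf_sum scaler_sumr.
  by apply: eq_bigr => l _; rewrite /= koszul_extZ scalerA mulrC.
rewrite exchange_big; apply: eq_bigr => l _; rewrite -scaler_suml mxE.
by under [in RHS]eq_bigr do rewrite mxE.
Qed.

(** * The cokernel of the first differential and the quotient N *)

Section Quotient.
Variables (q : nat) (n : 'I_q -> nat) (A : comNzRingType) (B : fieldType).
Variables (phi : {rmorphism A -> B}) (M : mgmod n A).
Variables (P : 'X_{1..q} -> M -> M) (PP : graded_projection P).
Variables (k : nat) (f : 'I_k -> {mpoly A[nvars n]}) (d : 'I_k -> 'X_{1..q}).
Variables (nu : 'X_{1..q}) (N0 N1 : nat).
Variable b0 : 'I_N0 -> {ffun {set 'I_k} -> coefmod M}.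
Variable b1 : 'I_N1 -> {ffun {set 'I_k} -> coefmod M}.
Variable E : 'M[A]_(N0, N1).
Hypothesis b0_basis : is_basis (koszul_comp (M := M) d nu 0) b0.
Hypothesis b0E : forall j, koszul_diff f (b1 j) = \sum_l E l j *: b0 l.

Local Notation Mext := (mg_extend phi M).

(** K_0 in multidegree nu is the component of M (x) B, and the first differential lands in (s)(M (x)
    B); hence a complement of the column space of its matrix generates the component of the
    quotient. *)
Lemma mg_quot_generators (s : seq {mpoly B[nvars n]}) :
  (forall i, map_mpoly phi (f i) \in s) ->
  exists (l : nat) (w : 'I_l -> mg_quot Mext s),
    [/\ (l + \rank (map_mx phi E) = N0)%N, forall t, mg_comp nu (w t)
      & forall x : mg_quot Mext s, mg_comp nu x ->
          exists c : 'rV[B]_l, x = \sum_t (c 0 t)%:MP *: w t].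
Proof.
move=> f_s; set F := map_mx phi E; pose C := ((F^T)^C)%MS.
pose W := row_base C; pose y t : Mext :=
  (\sum_l W t l *: koszul_ext phi (b0 l)) finset.set0.
pose S := [set x : Mext | exists2 g, g \in s & exists y : Mext, x = g *: y]%classic.
have PX := ext_graded_projection phi PP.
have ind0 : koszul_index d nu 0 finset.set0.
  by rewrite /koszul_index cards0 big_set0; apply/mnm_lepP => j; rewrite mnm0E.
have deg0 : (nu - \sum_(i in finset.set0) d i = nu)%MM by rewrite big_set0 subm0.
exists (\rank C), (fun t => lquot_pi S (y t)); split.
- by rewrite mxrank_compl mxrank_tr subnK // rank_leq_row.
- move=> t; exists (y t) => //; rewrite -[X in mg_comp X]deg0.
  apply: (@koszul_comp_in _ _ _ _ _ d nu 0 _ finset.set0) => //.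
  apply: (koszul_comp_sum PX) => l _; apply: (koszul_compZ PX).
  by apply: koszul_ext_comp; case: b0_basis.
move=> x [x0 Mx0 ->].
have [|c cE] := koszul_ext_span (phi := phi) PP b0_basis
    (x := koszul_delta (Q := Mext) finset.set0 x0).
  by apply: (koszul_delta_comp PX) => //; rewrite deg0.
have [[Z1 Z2] /= Z12] : exists u, 1%:M = u.1 *m F^T + u.2 *m W.
  apply/sub_addsmxP; rewrite (adds_eqmx (eqmx_refl _) (eq_row_base C)).
  by rewrite submx_full // addsmx_compl_full.
pose u := \sum_j (c *m Z1)^T j 0 *: koszul_ext phi (b1 j).
exists (c *m Z2); set c2 := c *m Z2.
have c12 : c = (F *m (c *m Z1)^T)^T + c2 *m W.
  by rewrite trmx_mul trmxK -[LHS]mulmx1 Z12 mulmxDr !mulmxA.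
have x0E : x0 = (koszul_diff (M := Mext) (fun i => map_mpoly phi (f i)) u) finset.set0 +
    \sum_t (c2 0 t)%:MP *: y t.
  transitivity ((koszul_diff (M := Mext) (fun i => map_mpoly phi (f i)) u +
      \sum_t c2 0 t *: \sum_l W t l *: koszul_ext phi (b0 l)) finset.set0); last first.
    rewrite ffunE; congr (_ + _); rewrite sum_ffunE; apply: eq_bigr => t _.
    by rewrite ffunE.
  have -> : x0 = koszul_delta (n := n) (Q := Mext) finset.set0 x0 (finset.set0 : {set 'I_k}).
    by rewrite /koszul_delta ffunE eqxx.
  rewrite cE (koszul_ext_diff_comb phi b0E); congr (fun_of_fin _ _).
  transitivity (\sum_l (F *m (c *m Z1)^T) l 0 *: koszul_ext phi (b0 l) +
                \sum_l (c2 *m W) 0 l *: koszul_ext phi (b0 l)).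
    rewrite -big_split; apply: eq_bigr => l _ /=; rewrite -scalerDl.
    by congr (_ *: _); rewrite {1}c12 mxE [X in X + _]mxE.
  congr (_ + _).
  transitivity (\sum_l \sum_t (c2 0 t * W t l) *: koszul_ext phi (b0 l)).
    by apply: eq_bigr => l _; rewrite -scaler_suml mxE.
  rewrite exchange_big; apply: eq_bigr => t _; rewrite scaler_sumr.
  by apply: eq_bigr => l _; rewrite scalerA.
rewrite {1}x0E raddfD /= [X in X + _](_ : _ = 0) ?add0r.
  rewrite raddf_sum; apply: eq_bigr => t _; exact: linearZ.
rewrite -[RHS](raddf0 (lquot_pi S)); apply/lquot_piP; rewrite subr0.
rewrite /koszul_diff ffunE; apply: rpred_sum => i _; rewrite -scalerA; apply: rpredZ.
by apply: mem_lspan; exists (map_mpoly phi (f i)) => //; eexists.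
Qed.

End Quotient.

Lemma mg_extend_generators (q : nat) (n : 'I_q -> nat) (A B : comNzRingType)
    (phi : {rmorphism A -> B}) (M : mgmod n A) nu l (w : 'I_l -> M) :
  (forall x : M, mg_comp nu x ->
     exists c : 'rV[A]_l, x = \sum_t (c 0 t)%:MP *: w t) ->
  forall x : coefmod (mg_extend phi M), mg_comp nu (x : mg_extend phi M) ->
    exists c : 'rV[B]_l, x = \sum_t c 0 t *: (ptens1 phi (w t) : coefmod (mg_extend phi M)).
Proof.
move=> span x /asboolP[k [a [u [uM ->]]]].
have /choice[c cP] : forall i, exists c : 'rV[A]_l,
    u i = \sum_t phi (c 0 t) *: (ptens1 phi (w t) : tens phi (coefmod M)).
  move=> i; have [y /span[c ->] ->] := uM i; exists c.
  rewrite raddf_sum; apply: eq_bigr => t _; exact: tens1Z.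
exists (\row_t \sum_i a i * phi (c i 0 t)).
transitivity (\sum_i \sum_t (a i * phi (c i 0 t)) *: (ptens1 phi (w t) : tens phi (coefmod M))).
  by apply: eq_bigr => i _; rewrite {1}cP scaler_sumr; apply: eq_bigr => t _; rewrite scalerA.
rewrite exchange_big; apply: eq_bigr => t _; rewrite mxE -scaler_suml.
exact/esym/ptens_scaleC.
Qed.

Lemma ideal_gen_tnth (R : comNzRingType) k (t : k.-tuple R) x :
  ideal_gen t x -> exists a : 'I_k -> R, x = \sum_i a i * tnth t i.
Proof.
move=> [c ->]; have e : size t = k := size_tuple t.
exists (fun i => c (cast_ord (esym e) i)).
rewrite (reindex (cast_ord (esym e))) /=; last first.
  by exists (cast_ord e) => i _; rewrite ?cast_ordK ?cast_ordKV.
by apply: eq_bigr => i _; rewrite (tnth_nth 0).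
Qed.

Lemma fgr_seq (q : nat) (n : 'I_q -> nat) (A : comNzRingType)
    (J : set {mpoly A[nvars n]}) (M : mgmod n A) r :
  fgr J M = Some r -> exists s : seq {mpoly A[nvars n]},
    [/\ size s = r, {in s, forall g, J g} & filter_regular_seq s M].
Proof.
rewrite /fgr /enat_sup; case: xgetP => [e _ eP e_r|_ //].
by move: eP; rewrite e_r => -[].
Qed.

Lemma multiples_nil (q : nat) (n : 'I_q -> nat) (A : comNzRingType)
    (M : mgmod n A) (x : M) : x \in lspan (multiples (Q := M) [::]) -> x = 0.
Proof. by move=> /asboolP[k [c [u [u0 ->]]]]; rewrite big1 // => i _; case: (u0 i). Qed.

Lemma free_inj (A : pzRingType) (V : lmodType A) k (v : 'I_k -> V) :
  (forall c : 'rV[A]_k, \sum_l c 0 l *: v l = 0 -> c = 0) ->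
  forall c c' : 'cV[A]_k,
    \sum_l c l 0 *: v l = \sum_l c' l 0 *: v l -> c = c'.
Proof.
move=> v_free c c' cc'; apply/eqP; rewrite -subr_eq0 -trmx_eq0; apply/eqP/v_free.
rewrite -[RHS](subrr (\sum_l c l 0 *: v l)) [X in _ = _ - X]cc' -sumrB.
by apply: eq_bigr => l _; rewrite !mxE scalerBl.
Qed.

(** * Exactness of the extended Koszul complex in terms of matrices *)

Section KoszulKernel.
Variables (q : nat) (n : 'I_q -> nat) (A B : comNzRingType).
Variables (phi : {rmorphism A -> B}) (M : mgmod n A).
Variables (P : 'X_{1..q} -> M -> M) (PP : graded_projection P).
Variables (k : nat) (f : 'I_k -> {mpoly A[nvars n]}) (d : 'I_k -> 'X_{1..q}).
Variables (nu : 'X_{1..q}) (m N : nat) (b : 'I_N -> {ffun {set 'I_k} -> coefmod M}).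

Local Notation Mext := (mg_extend phi M).
Local Notation diff_ext := (koszul_diff (M := Mext) (fun i => map_mpoly phi (f i))).
Local Notation ext := (koszul_ext phi).

Hypothesis b_basis : is_basis (koszul_comp (M := M) d nu m) b.

Let ext_inj := free_inj (koszul_ext_free (phi := phi) PP b_basis).

Lemma koszul_ext_kernel N' (b' : 'I_N' -> {ffun {set 'I_k} -> coefmod M})
    (E : 'M[A]_(N', N)) (z : 'cV[B]_N) :
  (forall j, koszul_diff f (b j) = \sum_l E l j *: b' l) ->
  (forall c, koszul_comp (M := Mext) d nu m c -> diff_ext c = 0 ->
     exists2 y, koszul_comp (M := Mext) d nu m.+1 y & c = diff_ext y) ->
  map_mx phi E *m z = 0 ->
  exists2 y, koszul_comp (M := Mext) d nu m.+1 y & \sum_l z l 0 *: ext (b l) = diff_ext y.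
Proof.
move=> bE exact_m Ez0; have PX := ext_graded_projection phi PP; apply: exact_m.
  apply: (koszul_comp_sum PX) => l _; apply: (koszul_compZ PX).
  by apply: koszul_ext_comp; case: b_basis.
rewrite (koszul_ext_diff_comb phi bE) Ez0 big1 // => l _.
by rewrite mxE scale0r.
Qed.

Lemma koszul_ext_image N' (b' : 'I_N' -> {ffun {set 'I_k} -> coefmod M})
    (E : 'M[A]_(N, N')) (z : 'cV[B]_N) y :
  is_basis (koszul_comp (M := M) d nu m.+1) b' ->
  (forall j, koszul_diff f (b' j) = \sum_l E l j *: b l) ->
  koszul_comp (M := Mext) d nu m.+1 y -> \sum_l z l 0 *: ext (b l) = diff_ext y ->
  exists w, z = map_mx phi E *m w.
Proof.
move=> b'_basis b'E yP zE; have [c yE] := koszul_ext_span PP b'_basis yP.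
exists c^T; apply: ext_inj; rewrite -(koszul_ext_diff_comb phi b'E) zE yE.
by congr koszul_diff; apply: eq_bigr => j _; rewrite mxE.
Qed.

Lemma koszul_ext_top (z : 'cV[B]_N) y : (k <= m)%N ->
  koszul_comp (M := Mext) d nu m.+1 y -> \sum_l z l 0 *: ext (b l) = diff_ext y ->
  z = 0.
Proof.
move=> le_km yP zE; apply: ext_inj; rewrite zE.
have -> : y = 0.
  apply/ffunP => J; rewrite [RHS]ffunE; apply: (koszul_comp_out yP).
  apply/negP => /andP[/eqP cardJ _].
  by have := max_card (mem J); rewrite card_ord cardJ leqNgt ltnS le_km.
by rewrite raddf0 big1 // => l _; rewrite mxE scale0r.
Qed.

End KoszulKernel.

(** [rdeg] measures dimensions over the fraction field of the base, even when the base [B] is a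
    field; the generators of the quotient are therefore extended once more and compared with the
    basis there. *)
Lemma rank_quot_basis (q : nat) (n : 'I_q -> nat) (A : comNzRingType) (B : fieldType)
    (phi : {rmorphism A -> B}) (M : mgmod n A)
    (P : 'X_{1..q} -> M -> M) (PP : graded_projection P)
    k (f : 'I_k -> {mpoly A[nvars n]}) (d : 'I_k -> 'X_{1..q}) nu N0 N1
    (b0 : 'I_N0 -> {ffun {set 'I_k} -> coefmod M}) (b1 : 'I_N1 -> _)
    (E : 'M[A]_(N0, N1)) (s : seq {mpoly B[nvars n]}) l
    (v : 'I_l -> coefmod (mg_extend (@tofrac B) (mg_quot (mg_extend phi M) s))) :
  is_basis (koszul_comp (M := M) d nu 0) b0 ->
  (forall j, koszul_diff f (b1 j) = \sum_l E l j *: b0 l) ->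
  (forall i, map_mpoly phi (f i) \in s) ->
  is_basis (mg_comp nu : set (coefmod (mg_extend (@tofrac B) (mg_quot (mg_extend phi M) s)))) v ->
  (\rank (map_mx phi E) + l <= N0)%N.
Proof.
move=> b0_basis b0E f_s v_basis.
have [l' [w [rkE wP w_span]]] := mg_quot_generators PP b0_basis b0E f_s.
rewrite -[X in (_ <= X)%N]rkE addnC leq_add2r.
apply: (leq_basis_span v_basis) _ (mg_extend_generators w_span) => t.
by apply: mem_lspan; exists (w t).
Qed.

Theorem theorem3p3
  (q : nat) (q_gt0 : (0 < q)%N)
  (n : 'I_q -> nat) (n_gt0 : forall j, (0 < n j)%N)
  (A : idomainType) (A_noetherian : noetherian A) (A_UFD : is_UFD A)
  (M : mgmod n A) (M_free : componentwise_free M)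
  (r : nat) (M_rdim : rdim M = r%:Z)
  (f : (r.+1).-tuple {mpoly A[nvars n]}) (d : 'I_r.+1 -> 'X_{1..q})
  (f_homog : forall i, multihomog (d i) (tnth f i))
  (f_regular : filter_regular_seq f M)
  (p : prime_idealr A) :
  let Mbar := mg_extend (residue p) M in
  let fbar := [seq map_mpoly (residue p) g | g <- f] in
  let N := mg_quot Mbar fbar in
  fgr (ideal_gen fbar) Mbar = Some r ->
  forall rho : A, mresultant M f d rho ->
  le_enat (rdeg N) (ord_at (to_loc p rho)).
Proof.
move=> Mbar fbar N fgr_r rho [_ rho_res].
have [->|rdeg_gt0] := posnP (rdeg N); first by case: (ord_at _).
apply: le_ord_at; set k := rdeg N in rdeg_gt0 *.
have [/graded_projection_exists[P PP] _ _] := M_free.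
have PX := ext_graded_projection (residue p) PP.
pose fb i := map_mpoly (residue p) (tnth f i).
have fbE i : fb i = tnth [tuple of fbar] i by rewrite tnth_map.
have fb_homog i : multihomog (d i) (fb i) by exact/multihomog_map/f_homog.
have [s [size_s s_ideal s_reg]] := fgr_seq fgr_r.
(* With r + 1 polynomials and a sequence of length r, the condition of [koszul_exact_depth] is r + 1
   < i + r, that is 1 < i; finitely many degrees share one threshold. *)
have koszul_exactness : eventually (fun nu => forall i, (i < r.+2)%N -> (1 < i)%N ->
    forall c, koszul_comp (M := Mbar) d nu i c -> koszul_diff fb c = 0 ->
    exists2 b, koszul_comp (M := Mbar) d nu i.+1 b & c = koszul_diff fb b).
  apply: eventually_forall => i _.
  have [i_gt1|i_le1] := ltnP 1 i; last by exists 0%MM.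
  have [||nu0 exact_i] := koszul_exact_depth PX fb_homog (m := i) s_reg _ _.
  - move=> g /s_ideal/(ideal_gen_tnth (t := [tuple of fbar]))[a ->]; exists a.
    by apply: eq_bigr => j _; rewrite fbE.
  - by rewrite size_s; move: i_gt1; lia.
  exists nu0 => nu /exact_i{}exact_i _ c cP dc0.
  have [J|b bP cb] := exact_i c cP; first by rewrite dc0 ffunE rpred0.
  exists b => //; apply/ffunP => J; apply/eqP; rewrite -subr_eq0; apply/eqP.
  exact: multiples_nil (cb J).
(* A single multidegree gives the determinant, a basis of the component of N, and exactness modulo
   p. *)
have [nu [[[m [b [dm [[m0 ms] bP DE det_neq0 [u u_unit rhoE]]]]] [v vP]] exact_nu]] :=
  eventually_ex (eventually_and (eventually_and rho_res (rdeg_basis rdeg_gt0))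
                                koszul_exactness).
(* [cayley_det] constrains the matrices only below r.+1; they are set to zero from there on to meet
   [d_s]. *)
pose dz i := if (i < r.+1)%N then dm i else 0.
have dzE i : (i < r.+1)%N -> dz i = dm i by rewrite /dz => ->.
have kM0 j : koszul_comp (M := M) d nu j 0 by exact: (koszul_comp0 PP).
apply: (@cayley_det_order A p r.+1 m dz m0 ms _ _ _ _ k rho u) => //.
- by rewrite /dz ltnn.
- move=> i lt_i; rewrite dzE //; have [lt_i1|] := ltnP i.+1 r.+1; last first.
    by rewrite /dz leqNgt => /negPf->; rewrite mulmx0.
  rewrite dzE //; apply/matrixP => l j; rewrite [RHS]mxE.
  (* The vanishing of the composite of two differentials passes to matrices since [b i] is free over
     A. *)
  have /(is_basis_free (bP i (ltnW lt_i)) (kM0 i)) :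
      \sum_l (col j (dm i *m dm i.+1))^T 0 l *: b i l = 0.
    rewrite -[RHS](koszul_diff2 (tnth f) (b i.+2 j)) DE // raddf_sum /=.
    transitivity (\sum_l \sum_l' (dm i l l' * dm i.+1 l' j) *: b i l).
      by apply: eq_bigr => l' _; rewrite -scaler_suml !mxE.
    rewrite exchange_big; apply: eq_bigr => l' _; rewrite linearZ_LR /= DE // scaler_sumr.
    by apply: eq_bigr => l'' _; rewrite scalerA mulrC.
  by move=> /(congr1 (fun X : 'rV__ => X 0 l)); rewrite !mxE.
(* A kernel vector of [d i] modulo p is a cycle of degree i + 1, at least 2, hence a boundary; in
   the top degree there is nothing above, so it is zero. *)
- move=> i /andP[i_gt0 lt_i] z; rewrite dzE // => dz0.
  have [y yP zE] := koszul_ext_kernel PP (bP i.+1 lt_i) (DE i lt_i)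
    (exact_nu i.+1 lt_i i_gt0) dz0.
  have [lt_i1|le_i1] := ltnP i.+1 r.+1.
    rewrite dzE //.
    have [w zw] :=
      koszul_ext_image PP (bP i.+1 lt_i) (bP i.+2 lt_i1) (DE i.+1 lt_i1) yP zE.
    by exists w.
  have z0 := koszul_ext_top PP (bP i.+1 lt_i) le_i1 yP zE.
  by exists 0; rewrite z0 mulmx0.
- by move=> i lt_i; rewrite dzE //; exact: det_neq0.
- have f_fbar i : map_mpoly (residue p) (tnth f i) \in fbar.
    by apply: map_f; exact: mem_tnth.
  have := rank_quot_basis PP (bP 0 isT) (DE 0 isT) f_fbar vP.
  (* C_0 has rank m 1 + m 0, which is m 1. *)
  by rewrite dzE // [X in (_ <= _ + X)%N]m0 addn0.
by rewrite rhoE; congr (_ * _); apply: eq_bigr => i _; rewrite dzE.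
Qed.
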